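(* Assume that $b,\sigma,m_{ij}$ are continuous; that for every $R>0$ there is $C_R>0$ with $\sum_{k,l}a^{kl}(x,i)z_kz_l\ge C_R^{-1}|z|^2$ for all $|x|<R$, $i\in\mathbb{S}$, $z\in\mathbb{R}^d$, where $a=\frac12\sigma\sigma^{\mathsf T}$; that there are $C_L,M_2>0$ such that $$|b(x,i,\zeta)-b(y,i,\zeta)|^2+\|\sigma(x,i)-\sigma(y,i)\|^2+|m_{ij}(x)-m_{ij}(y)|^2\le C_L|x-y|^2,\qquad |b(x,i,\zeta)|^2+\|\sigma(x,i)\|^2+|m_{ij}(x)|^2\le M_2$$ for all $x,y\in\mathbb{R}^d$, $i,j\in\mathbb{S}$, $\zeta\in\mathbb{U}$; and that the running cost $c:\mathbb{R}^d\times\mathbb{S}\times\mathbb{U}\to\mathbb{R}_+$ and the terminal cost $c_T$ (with $c_T\in W^{2,p}_{\mathrm{loc}}(\mathbb{R}^d\times\mathbb{S})$ for some $p\ge2$) satisfy, for some $C_{L_c},M_3>0$ and all $x,y,i,\zeta,\zeta'$, $$|c(x,i,\zeta)-c(y,i,\zeta')|\le C_{L_c}(|x-y|+d_{\mathbb{U}}(\zeta,\zeta')),\quad|c_T(x,i)-c_T(y,i)|\le C_{L_c}|x-y|,\quad|c(x,i,\zeta)|+|c_T(x,i)|\le M_3.$$ Fix $T>0$, $h>0$, $K=\lfloor T/h\rfloor$, and let $v_n$ ($n\ge1$) be the policies obtained from the finite-state approximations of the compact-state models $\mathcal{M}^{\mathcal{X}_n}_h$, extended to $\mathbb{R}^d\times\mathbb{S}$.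 Then for every $k\in\{0,\dots,K\}$ and any compact set $\mathcal{K}\subset\mathbb{R}^d$, $$\lim_{n\to\infty}\sup_{(x,i)\in\mathcal{K}\times\mathbb{S}}\big|\mathcal{J}^{v_n}_{k,h}(x,i)-\mathcal{J}^*_{k,h}(x,i)\big|=0.$$ Therefore $\lim_{n\to\infty}|\mathcal{J}^{v_n}_{k,h}(x,i)-\mathcal{J}^*_{k,h}(x,i)|=0$ for all $(x,i)\in\mathbb{R}^d\times\mathbb{S}$.
   Context: Setting. $(\mathbb{U},d_{\mathbb{U}})$ is a compact metric space, $\mathbb{S}=\{1,\dots,N\}$; $b:\mathbb{R}^d\times\mathbb{S}\times\mathbb{U}\to\mathbb{R}^d$, $\sigma:\mathbb{R}^d\times\mathbb{S}\to\mathbb{R}^{d\times d}$, and switching rates $m_{ij}:\mathbb{R}^d\to\mathbb{R}$ (independent of the action) with $m_{ij}\ge0$ for $i\ne j$, $\sum_jm_{ij}=0$; $\|\sigma\|=\sqrt{\mathrm{Tr}(\sigma\sigma^{\mathsf T})}$. MDP $\mathcal{M}_h$: states $\mathbb{R}^d\times\mathbb{S}$, actions $\mathbb{U}$, one-stage cost $c_h=h\,c$, terminal cost $c_T$, stages $0,\dots,K$, and kernel $P_h(dy,j\mid x,i,\zeta)$ equal to the one-step law of the Euler--Maruyama chain: the law of $(X^h_h,S^h_h)$ where $X^h_h=x+b(x,i,\zeta)h+\sigma(x,i)W_h$ ($W$ a standard $d$-dimensional Wiener process) and $S^h$ is, independently of $W$, the continuous-time Markov chain on $[0,h]$ started at $i$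 with constant rate matrix $(m_{jl}(x))_{j,l}$. Write $\int f\,dP_h=\sum_j\int f(y,j)P_h(dy,j\mid x,i,\zeta)$. For a deterministic Markov policy $v:\{0,\dots,K-1\}\times\mathbb{R}^d\times\mathbb{S}\to\mathbb{U}$ (measurable): $\mathcal{J}^v_{K,h}=c_T$, $\mathcal{J}^v_{k,h}(x,i)=c_h(x,i,v(k,x,i))+\int\mathcal{J}^v_{k+1,h}(y,j)P_h(dy,dj\mid x,i,v(k,x,i))$. Optimal values: $\mathcal{J}^*_{K,h}=c_T$, $\mathcal{J}^*_{k,h}(x,i)=\inf_{\zeta\in\mathbb{U}}\big[c_h(x,i,\zeta)+\int\mathcal{J}^*_{k+1,h}(y,j)P_h(dy,dj\mid x,i,\zeta)\big]$. Compact-state models $\mathcal{M}^{\mathcal{X}_n}_h$: $\mathcal{K}_n\subset\mathbb{R}^d$ are compact with $\mathcal{K}_n\subset\mathrm{int}\,\mathcal{K}_{n+1}$, $\bigcup_n\mathcal{K}_n=\mathbb{R}^d$; $\mu_n$ is a probability measure on $\mathcal{K}_n^c$; $\mathcal{X}_n=\mathcal{K}_n\cup\{\Delta_n\}$ with a pseudo-state $\Delta_n\in\mathcal{K}_n^c$. States $\mathcal{X}_n\times\mathbb{S}$, actions $\mathbb{U}$; for $x\in\mathcal{K}_n$: $p_{\mathcal{X}_n}(\cdot,j\mid x,i,\zeta)=P_h(\cdot\cap\mathcal{K}_n,j\mid x,i,\zeta)+P_h(\mathcal{K}_n^c,j\mid x,i,\zeta)\delta_{\Delta_n}$, cost $c_{\mathcal{X}_n}=c_h(x,i,\zeta)$,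 terminal cost $\hat c^n_T=c_T(x,i)$; for $x=\Delta_n$ the kernel, cost and terminal cost are the $\mu_n(dz)$-averages over $z\in\mathcal{K}_n^c$ of $P_h(\cdot\cap\mathcal{K}_n,j\mid z,i,\zeta)+P_h(\mathcal{K}_n^c,j\mid z,i,\zeta)\delta_{\Delta_n}$, $c_h(z,i,\zeta)$, $c_T(z,i)$. Write $\bar{\mathcal{J}}^{n,v}_{k,h}$ and $\bar{\mathcal{J}}^{n*}_{k,h}$ for the cost from stage $k$ of a policy $v$ and the optimal value from stage $k$ in this model. Finite-state approximations of $\mathcal{M}^{\mathcal{X}_n}_h$: choose a finite grid in the compact metric space $\mathcal{X}_n$ that is a $1/m$-net, the nearest-neighbour quantizer $\mathcal{Q}$ (ties broken by smallest index), its cells $\mathcal{S}_l$ around the grid points $z_l$, and a probability measure $\nu$ on $\mathcal{X}_n$ charging every cell, with $\nu_l$ its normalized restriction to $\mathcal{S}_l$. The finite model has states (grid)$\times\mathbb{S}$, kernel $\int_{\mathcal{S}_l}p_{\mathcal{X}_n}(\mathcal{Q}^{-1}(\cdot),j\mid z,i,\zeta)\nu_l(dz)$, cost $\int_{\mathcal{S}_l}c_{\mathcal{X}_n}(z,i,\zeta)\nu_l(dz)$ at $(z_l,i)$, and terminal cost $\hat c^n_T$ at grid points. An optimal Markov policy of it is extended to $\mathcal{X}_n\times\mathbb{S}$ by composition with $\mathcal{Q}$. The policies $v_n$: fix $\varepsilon_n\downarrow0$ (positive reals tending to $0$). For each $n$, $v_n$ is the (extended) optimal policy of such a finite-state approximation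 of $\mathcal{M}^{\mathcal{X}_n}_h$ with grid fine enough that $\sup_{(x,i)\in\mathcal{X}_n\times\mathbb{S}}|\bar{\mathcal{J}}^{n,v_n}_{k,h}(x,i)-\bar{\mathcal{J}}^{n*}_{k,h}(x,i)|\le\varepsilon_n$ for all $k$; it is extended to $\mathbb{R}^d\times\mathbb{S}$ by $v_n(k,x,i)=v_n(k,\Delta_n,i)$ for $x\in\mathcal{K}_n^c$. *)

(* Defs.v *)
From HB Require Import structures.
From mathcomp Require Import all_boot all_order all_algebra.
From mathcomp Require Import all_classical all_reals all_analysis.

Set Implicit Arguments.
Unset Strict Implicit.
Unset Printing Implicit Defensive.
Import Order.TTheory GRing.Theory Num.Theory.
Import numFieldNormedType.Exports.

Local Open Scope classical_set_scope.
Local Open Scope ring_scope.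

(* Matrices, in particular vectors of R^d seen as rows 'rV[R]_d, carry the
   Borel sigma-algebra of the topology of the library. *)
HB.instance Definition _ (R : realType) (m n : nat) :=
  @isMeasurable.Build (sigma_display (@open 'M[R]_(m, n))) 'M[R]_(m, n)
    <<s @open 'M[R]_(m, n) >> (@sigma_algebra0 _ setT _) (@sigma_algebraC _ _)
    (@sigma_algebra_bigcup _ setT _).

Section Euclidean.
Context (R : realType).

(* The norm of the library on matrices is the sup norm; distances in the
   statements are Euclidean. *)
Definition enorm d (x : 'rV[R]_d) : R := Num.sqrt (\sum_(k < d) x 0 k ^+ 2).

Definition frob d (s : 'M[R]_d) : R := Num.sqrt (\tr (s *m s^T)).

(* The d-fold product m \x ... \x m, as a set function on 'rV[R]_d. *)
Fixpoint rV_prod (m : set (measurableTypeR R) -> \bar R) (d : nat) :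
    set 'rV[R]_d -> \bar R :=
  match d return set 'rV[R]_d -> \bar R with
  | 0 => \d_(0 : 'rV[R]_0)
  | d'.+1 => pushforward (m \x @rV_prod m d')%E
               (fun y : measurableTypeR R * 'rV[R]_d' =>
                 row_mx (y.1 : R)%:M y.2 : 'rV[R]_(1 + d'))
  end.

Definition lebesgue_rV (d : nat) : set 'rV[R]_d -> \bar R :=
  @rV_prod lebesgue_measure d.

(* The law N(0, h I_d) of W_h, for W a standard d-dimensional Wiener process;
   the second parameter of normal_prob is the standard deviation. *)
Definition wiener_law (d : nat) (h : R) : set 'rV[R]_d -> \bar R :=
  @rV_prod (normal_prob 0 (Num.sqrt h)) d.

(* exp (h Q): the transition matrix over a time h of the continuous-time Markov
   chain with constant rate matrix Q. *)
Definition ctmc_trans N (h : R) (Q : 'M[R]_N) : 'M[R]_N :=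
  \matrix_(i, j) limn (series (fun k => ((h *: Q) ^+ k) i j / k`!%:R)).

(* Supremum in [0, +oo], so that it is 0 over the empty set. *)
Definition sup_abs (T : Type) (N : nat) (A : set T) (f : T -> 'I_N -> R) :
    \bar R :=
  maxe 0%E (ereal_sup [set `|f x.1 x.2|%:E | x in A `*` [set: 'I_N]]).

End Euclidean.

Section Sobolev.
Context (R : realType) (d : nat).
Implicit Types (f g phi : 'rV[R]_d -> R) (s : seq 'I_d) (p : R).

Definition partials s f : 'rV[R]_d -> R :=
  foldr (fun k g => 'D_(delta_mx 0 k) g) f s.

Definition test_function phi : Prop :=
  (forall s, continuous (partials s phi) /\
     forall x k, derivable (partials s phi) x (delta_mx 0 k)) /\
  exists2 A : set 'rV[R]_d, compact A & forall x, ~ A x -> phi x = 0.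

Definition weak_partial s f g : Prop := forall phi, test_function phi ->
  (\int[@lebesgue_rV R d]_x (f x * partials s phi x)%:E =
   ((-1) ^+ size s)%:E * \int[@lebesgue_rV R d]_x (g x * phi x)%:E)%E.

Definition Lp_loc p f : Prop := measurable_fun [set: 'rV[R]_d] f /\
  forall A : set 'rV[R]_d, compact A ->
    (\int[@lebesgue_rV R d]_(x in A) (`|f x| `^ p)%:E < +oo)%E.

Definition W2p_loc p f : Prop := Lp_loc p f /\
  forall s, (size s <= 2)%N -> exists2 g, Lp_loc p g & weak_partial s f g.

End Sobolev.

(* Finite-horizon Markov decision processes with stages 0, ..., K, state space
   X * 'I_N and actions U; E f x i u is the integral of f against the
   transition kernel at the state (x, i) under the action u. *)
Section MDP.
Context (R : realType) (X U : Type) (N : nat) (K : nat).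
Variables (c : X -> 'I_N -> U -> R) (cT : X -> 'I_N -> R).
Variable E : (X -> 'I_N -> R) -> X -> 'I_N -> U -> R.

Fixpoint cost_to_go (v : nat -> X -> 'I_N -> U) (r : nat) : X -> 'I_N -> R :=
  if r is r'.+1 then fun x i =>
    c x i (v (K - r)%N x i) + E (cost_to_go v r') x i (v (K - r)%N x i)
  else cT.

Definition policy_cost v (k : nat) : X -> 'I_N -> R := cost_to_go v (K - k).

Fixpoint opt_to_go (r : nat) : X -> 'I_N -> R :=
  if r is r'.+1 then fun x i =>
    inf [set c x i u + E (opt_to_go r') x i u | u in [set: U]]
  else cT.

Definition opt_value (k : nat) : X -> 'I_N -> R := opt_to_go (K - k).

Definition optimal_policy (v : nat -> X -> 'I_N -> U) : Prop :=
  forall w x i, policy_cost v 0 x i <= policy_cost w 0 x i.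

End MDP.

(* P x i u j A is the probability to jump from (x, i) to A * {j} under u. *)
Definition kernel_fun (R : realType) (d N : nat) (U : Type) :=
  'rV[R]_d -> 'I_N -> U -> 'I_N -> set 'rV[R]_d -> \bar R.

Definition kernel_int (R : realType) (d N : nat) (U : Type)
    (P : kernel_fun R d N U) (f : 'rV[R]_d -> 'I_N -> R) x i u : R :=
  \sum_(j < N) fine (\int[P x i u j]_y (f y j)%:E)%E.

Section EulerMaruyama.
Context (R : realType) (d N : nat) (U : Type).
Variables (b : 'rV[R]_d -> 'I_N -> U -> 'rV[R]_d).
Variables (sigma : 'rV[R]_d -> 'I_N -> 'M[R]_d) (m : 'rV[R]_d -> 'M[R]_N).
Variable h : R.

(* Vectors are rows, hence the transpose of sigma acts on the right. *)
Definition em_map x i u (w : 'rV[R]_d) : 'rV[R]_d :=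
  x + h *: b x i u + w *m (sigma x i)^T.

(* Joint law of the two independent variables X^h_h and S^h_h. *)
Definition em_kernel : kernel_fun R d N U := fun x i u j A =>
  ((ctmc_trans h (m x) i j)%:E *
   pushforward (@wiener_law R d h) (em_map x i u) A)%E.

End EulerMaruyama.

Section CompactState.
Context (R : realType) (d N : nat) (U : Type).
Variables (P : kernel_fun R d N U) (c : 'rV[R]_d -> 'I_N -> U -> R).
Variables (cT : 'rV[R]_d -> 'I_N -> R).
Variables (A : set 'rV[R]_d) (Delta : 'rV[R]_d) (mu : set 'rV[R]_d -> \bar R).

Definition cstate : set 'rV[R]_d := A `|` [set Delta].

Definition collapsed_kernel : kernel_fun R d N U := fun x i u j B =>
  (P x i u j (B `&` A) + P x i u j (~` A) * \d_Delta B)%E.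

(* The functions below only matter on A and at Delta, which is not in A. *)
Definition cstate_kernel : kernel_fun R d N U := fun x i u j B =>
  if x \in A then collapsed_kernel x i u j B
  else (\int[mu]_(z in ~` A) collapsed_kernel z i u j B)%E.

Definition cstate_cost x i u : R :=
  if x \in A then c x i u else fine (\int[mu]_(z in ~` A) (c z i u)%:E)%E.

Definition cstate_term x i : R :=
  if x \in A then cT x i else fine (\int[mu]_(z in ~` A) (cT z i)%:E)%E.

End CompactState.

(* A finite-state approximation of a model with state space X * 'I_N: a finite
   grid that is a 1/m-net of X, the nearest-neighbour quantizer onto it (with
   ties broken by the smallest index) and a probability measure on X which
   charges every cell of the quantizer. *)
Record discretization (R : realType) (d : nat) (X : set 'rV[R]_d) := {
  mesh : nat;
  grid_size : nat;
  grid : 'I_grid_size -> 'rV[R]_d;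
  quant : 'rV[R]_d -> 'I_grid_size;
  cell_law : probability 'rV[R]_d R;
  mesh_gt0 : (0 < mesh)%N;
  grid_sub : forall l, X (grid l);
  grid_net : forall x, X x -> exists l, enorm (x - grid l) <= mesh%:R^-1;
  quant_min : forall x l, X x ->
    enorm (x - grid (quant x)) <= enorm (x - grid l);
  quant_tie : forall x (l : 'I_grid_size), X x -> (l < quant x)%N ->
    enorm (x - grid (quant x)) < enorm (x - grid l);
  cell_law_supp : cell_law X = 1%E;
  cell_law_pos : forall l, (0 < cell_law [set x | X x /\ quant x = l])%E }.

Section FiniteState.
Context (R : realType) (d N : nat) (U : Type) (X : set 'rV[R]_d).
Variables (D : discretization X) (P : kernel_fun R d N U).
Variables (c : 'rV[R]_d -> 'I_N -> U -> R) (cT : 'rV[R]_d -> 'I_N -> R).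

Definition cell (l : 'I_(grid_size D)) : set 'rV[R]_d :=
  [set x | X x /\ quant D x = l].

Definition cond_law l : set 'rV[R]_d -> \bar R := fun B =>
  (cell_law D (B `&` cell l) * (fine (cell_law D (cell l)))^-1%:E)%E.

Definition fin_kernel (l : 'I_(grid_size D)) (i : 'I_N) (u : U)
    (l' : 'I_(grid_size D)) (j : 'I_N) : R :=
  fine (\int[cond_law l]_(z in cell l) P z i u j (cell l'))%E.

Definition fin_int (f : 'I_(grid_size D) -> 'I_N -> R) l i u : R :=
  \sum_l' \sum_(j < N) fin_kernel l i u l' j * f l' j.

Definition fin_cost (l : 'I_(grid_size D)) (i : 'I_N) (u : U) : R :=
  fine (\int[cond_law l]_(z in cell l) (c z i u)%:E)%E.

Definition fin_term (l : 'I_(grid_size D)) (i : 'I_N) : R := cT (grid l) i.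

Definition fin_optimal (K : nat) :
    (nat -> 'I_(grid_size D) -> 'I_N -> U) -> Prop :=
  optimal_policy K fin_cost fin_term fin_int.

(* Composition with the quantizer on X = A `|` [set Delta], and the value at
   Delta outside of A. *)
Definition extend_policy (A : set 'rV[R]_d) (Delta : 'rV[R]_d)
    (f : nat -> 'I_(grid_size D) -> 'I_N -> U) (k : nat) (x : 'rV[R]_d)
    (i : 'I_N) : U :=
  f k (quant D (if x \in A then x else Delta)) i.

End FiniteState.

(* Main.v *)
Require Import Defs.
From HB Require Import structures.
From mathcomp Require Import all_boot all_order all_algebra.
From mathcomp Require Import all_classical all_reals all_analysis.
From mathcomp Require Import measurable_realfun ring lra.

Set Implicit Arguments.
Unset Strict Implicit.
Unset Printing Implicit Defensive.
Import Order.TTheory GRing.Theory Num.Theory.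
Import numFieldNormedType.Exports.

Local Open Scope classical_set_scope.
Local Open Scope ring_scope.

(* All three families of functions involved - the optimal values of the compact
   models, their policy costs and the policy costs of the original model - are
   shown to converge, uniformly on balls and with uniform bounds, to the optimal
   value J* of the original model, by induction on the number of remaining
   stages. For one stage, the one-step law from a ball stays, up to a small
   probability uniform in the action, in a bigger ball, which is eventually
   contained in K_n; on it the integrands are close and the two kernels agree.
   J* itself is bounded and uniformly continuous, because the Euler-Maruyama map
   is Lipschitz in the state, uniformly in the action and in bounded noise; in
   particular it is measurable. No other value function is known to be
   measurable: their integrals are controlled by squeezing the integrand between
   J* - g and J* + g for a measurable g, the integral being monotone even on
   non-measurable functions. *)

(** * Transition matrices *)

Section MatrixPowers.
Context (R : realType) (N : nat).
Implicit Types (A B : 'M[R]_N) (i j : 'I_N) (a e : R).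

(** The maximal absolute row sum is a submultiplicative norm on matrices. *)
Lemma exprmx_row_sum A a i k : (forall i, \sum_j `|A i j| <= a) ->
  \sum_j `|(A ^+ k) i j| <= a ^+ k.
Proof.
move=> Aa; elim: k i => [|k IH] i.
  rewrite !expr0 (bigD1 i)//= big1 => [|j ji]; rewrite !mxE.
    by rewrite eqxx addr0 normr1.
  by rewrite eq_sym (negbTE ji) normr0.
have a0 : 0 <= a by apply: le_trans (Aa i); exact: sumr_ge0.
rewrite exprS; apply: (@le_trans _ _ (\sum_l `|A i l| * \sum_j `|(A ^+ k) l j|)).
  under [leRHS]eq_bigr => l _ do rewrite mulr_sumr.
  rewrite exchange_big/=; apply: ler_sum => j _.
  rewrite -mulmxE mxE; apply: le_trans (ler_norm_sum _ _ _) _.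
  by apply: ler_sum => l _; rewrite normrM.
apply: (@le_trans _ _ (\sum_l `|A i l| * a ^+ k)).
  by apply: ler_sum => l _; rewrite ler_wpM2l.
by rewrite -mulr_suml exprS ler_wpM2r// exprn_ge0.
Qed.

(** Telescoping: [A ^+ k.+1 - B ^+ k.+1 = A * (A ^+ k - B ^+ k) + (A - B) * B ^+ k]. The factor is
    the derivative of [a ^+ k], so that after division by [k!] the bounds sum up to [expR a * e]. *)
Lemma exprmxB_row_sum A B a e i k : (forall i, \sum_j `|A i j| <= a) ->
    (forall i, \sum_j `|B i j| <= a) ->
    (forall i, \sum_j `|A i j - B i j| <= e) ->
  \sum_j `|(A ^+ k) i j - (B ^+ k) i j| <= k%:R * a ^+ k.-1 * e.
Proof.
move=> Aa Ba ABe; elim: k i => [|k IH] i.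
  by rewrite !expr0 mul0r mul0r big1// => j _; rewrite subrr normr0.
have a0 : 0 <= a by apply: le_trans (Aa i); exact: sumr_ge0.
have e0 : 0 <= e by apply: le_trans (ABe i); exact: sumr_ge0.
apply: (@le_trans _ _ (\sum_l (`|A i l| * \sum_j `|(A ^+ k) l j - (B ^+ k) l j|)
   + \sum_l (`|A i l - B i l| * \sum_j `|(B ^+ k) l j|))).
  under eq_bigr => j _ do rewrite !exprS -!mulmxE !mxE.
  under [X in _ <= X + _]eq_bigr => l _ do rewrite mulr_sumr.
  under [X in _ <= _ + X]eq_bigr => l _ do rewrite mulr_sumr.
  rewrite [X in _ <= X + _]exchange_big [X in _ <= _ + X]exchange_big/=.
  rewrite -big_split/=; apply: ler_sum => j _.
  rewrite -sumrB -big_split/=; apply: le_trans (ler_norm_sum _ _ _) _.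
  apply: ler_sum => l _; rewrite -!normrM.
  apply: le_trans (ler_normD _ _).
  by rewrite mulrBr mulrBl addrA subrK.
rewrite (@le_trans _ _ (a * (k%:R * a ^+ k.-1 * e) + e * a ^+ k))//; last first.
  (* The case [k = 0] is apart because [k.-1] truncates there. *)
  case: k {IH} => [|k]; first by rewrite !mul0r mulr0 add0r mul1r mulrC.
  by rewrite [k.+1.-1]/= [k.+2.-1]/= -(natr1 k.+1) exprS; lra.
rewrite lerD//.
  apply: (@le_trans _ _ (\sum_l `|A i l| * (k%:R * a ^+ k.-1 * e))).
    by apply: ler_sum => l _; rewrite ler_wpM2l.
  by rewrite -mulr_suml ler_wpM2r// !mulr_ge0// exprn_ge0.
apply: (@le_trans _ _ (\sum_l `|A i l - B i l| * a ^+ k)).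
  by apply: ler_sum => l _; rewrite ler_wpM2l// exprmx_row_sum.
by rewrite -mulr_suml ler_wpM2r// exprn_ge0.
Qed.

End MatrixPowers.

(** Serves to compare ['C(n, k) / n ^ k] with [1 / k!]. *)
Lemma ffact_le_expn n k : (n ^_ k <= n ^ k)%N.
Proof.
elim: k => // k IH; rewrite ffactnSr expnSr leq_mul//; exact: leq_subr.
Qed.

Section TransitionMatrix.
Context (R : realType) (N : nat).
Implicit Types (A B Q : 'M[R]_N) (i j : 'I_N) (a e h : R).

Let expmx_coeff A i j : R^nat := fun k => (A ^+ k) i j / k`!%:R.

Lemma exprZmx a A k : (a *: A) ^+ k = a ^+ k *: A ^+ k.
Proof.
elim: k => [|k IH]; first by rewrite !expr0 scale1r.
by rewrite !exprS -!mulmxE IH -scalemxAl -scalemxAr scalerA.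
Qed.

Lemma row_sum_bound A i : \sum_j `|A i j| <= \sum_i \sum_j `|A i j|.
Proof.
rewrite [leRHS](bigD1 i)//= lerDl; apply: sumr_ge0 => l _; exact: sumr_ge0.
Qed.

Let expmx_coeff_le A a i j k : (forall i, \sum_j `|A i j| <= a) ->
  `|expmx_coeff A i j k| <= exp_coeff a k.
Proof.
move=> Aa; rewrite /expmx_coeff/exp_coeff/= normrM normfV.
rewrite [`|k`!%:R|]ger0_norm ?ler0n//.
rewrite ler_wpM2r ?invr_ge0 ?ler0n//.
apply: le_trans (exprmx_row_sum i k Aa).
by rewrite (bigD1 j)//= lerDl sumr_ge0.
Qed.

Let is_cvg_expmx A i j : cvgn (series (expmx_coeff A i j)).
Proof.
apply: normed_cvg.
apply: series_le_cvg (is_cvg_series_exp_coeff (\sum_i \sum_j `|A i j|)).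
- by move=> k; exact: normr_ge0.
- by move=> k; apply: exp_coeff_ge0; apply: sumr_ge0 => ? _; exact: sumr_ge0.
- by move=> k; apply: expmx_coeff_le; exact: row_sum_bound.
Qed.

(** Zero row sums are inherited by all positive powers, so only the zeroth term of the exponential
    series contributes to the row sum. *)
Lemma ctmc_trans_sum1 h Q i : (forall i, \sum_j Q i j = 0) ->
  \sum_j ctmc_trans h Q i j = 1.
Proof.
move=> Q0; set A := h *: Q.
have A0 l : \sum_j A l j = 0.
  by under eq_bigr do rewrite mxE; rewrite -mulr_sumr Q0 mulr0.
have Ak k : \sum_j (A ^+ k) i j = (k == 0)%:R.
  case: k => [|k].
    rewrite expr0 (bigD1 i)//= big1 => [|j ji]; rewrite !mxE ?eqxx ?addr0//.
    by rewrite eq_sym (negbTE ji).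
  under eq_bigr do rewrite exprSr -mulmxE mxE.
  by rewrite exchange_big big1// => l _; rewrite -mulr_sumr A0 mulr0.
have cs : \sum_j series (expmx_coeff A i j) n @[n --> \oo] -->
    \sum_j ctmc_trans h Q i j.
  apply: cvg_big => [|j _]; first exact: add_continuous.
  by rewrite mxE; exact: is_cvg_expmx.
apply: (cvg_unique _ cs) => //.
apply: cvg_near_cst; near=> n.
rewrite /series/= exchange_big/=.
have n0 : (0 < n)%N by near: n; exact: nbhs_infty_gt.
rewrite -(prednK n0) big_nat_recl//= -mulr_suml Ak eqxx fact0 divr1.
rewrite big1 ?addr0// => k _.
by rewrite -mulr_suml Ak mul0r.
Unshelve. all: by end_near. Qed.

(** Termwise comparison: the zeroth terms cancel, and the term of order [k.+1] differs by at most
    [exp_coeff a k * e] by [exprmxB_row_sum]. *)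
Lemma ctmc_trans_lip h Q Q' a e i j :
    (forall i, \sum_j `|h * Q i j| <= a) ->
    (forall i, \sum_j `|h * Q' i j| <= a) ->
    (forall i, \sum_j `|h * Q i j - h * Q' i j| <= e) ->
  `|ctmc_trans h Q i j - ctmc_trans h Q' i j| <= expR a * e.
Proof.
move=> Qa Q'a QQ'; rewrite !mxE.
set A := h *: Q; set B := h *: Q'.
have Aa l : \sum_j `|A l j| <= a by under eq_bigr do rewrite mxE.
have Ba l : \sum_j `|B l j| <= a by under eq_bigr do rewrite mxE.
have ABe l : \sum_j `|A l j - B l j| <= e by under eq_bigr do rewrite !mxE.
have a0 : 0 <= a by apply: le_trans (Aa i); exact: sumr_ge0.
have e0 : 0 <= e by apply: le_trans (ABe i); exact: sumr_ge0.
have cAB : `|series (expmx_coeff A i j) n - series (expmx_coeff B i j) n|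
    @[n --> \oo] --> `|limn (series (expmx_coeff A i j))
       - limn (series (expmx_coeff B i j))|.
  by apply: cvg_norm; apply: cvgB; exact: is_cvg_expmx.
rewrite -(cvg_lim _ cAB)//; apply: limr_le; first exact: cvgP cAB.
near=> n; rewrite /series/= -sumrB.
apply: le_trans (ler_norm_sum _ _ _) _.
have n0 : (0 < n)%N by near: n; exact: nbhs_infty_gt.
rewrite -(prednK n0) big_nat_recl//= /expmx_coeff !expr0 subrr normr0 add0r.
apply: (@le_trans _ _ (series (exp_coeff a) n.-1 * e)).
  rewrite /series/= mulr_suml; apply: ler_sum => k _.
  rewrite -mulrBl normrM normfV [`|(k.+1)`!%:R|]ger0_norm ?ler0n//.
  rewrite ler_pdivrMr ?ltr0n ?fact_gt0//.
  have -> : exp_coeff a k * e * (k.+1)`!%:R = k.+1%:R * a ^+ k * e.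
    rewrite /exp_coeff/= factS natrM; field.
    by rewrite pnatr_eq0 -lt0n fact_gt0.
  apply: le_trans (exprmxB_row_sum i k.+1 Aa Ba ABe).
  by rewrite [leRHS](bigD1 j)//= lerDl sumr_ge0.
rewrite ler_wpM2r//.
apply: nondecreasing_cvgn_le; last exact: is_cvg_series_exp_coeff.
move=> x y xy; apply: nondecreasing_series => // k _ _; exact: exp_coeff_ge0.
Unshelve. all: by end_near. Qed.

(* [(1 + A / n) ^+ n] has nonnegative entries for [n] large and differs from
   the [n]-th partial sum of [exp A] by at most the same difference for the
   scalar [a], because [1 / k! - 'C(n, k) / n ^ k >= 0]. *)
Lemma ctmc_trans_ge0 h Q i j : 0 <= h -> (forall i j, i != j -> 0 <= Q i j) ->
  0 <= ctmc_trans h Q i j.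
Proof.
move=> h0 Q0; rewrite mxE.
have : forall k l, k != l -> 0 <= (h *: Q) k l.
  by move=> k l kl; rewrite mxE mulr_ge0// Q0.
move: (h *: Q) => A A0.
set a := \sum_i \sum_j `|A i j|.
have Aa : forall i, \sum_j `|A i j| <= a by exact: row_sum_bound.
have a0 : 0 <= a by apply: sumr_ge0 => ? _; exact: sumr_ge0.
have Aa1 k l : `|A k l| <= a.
  by apply: le_trans (Aa k); rewrite (bigD1 l)//= lerDl sumr_ge0.
have lower n : (0 < n)%N -> a <= n%:R ->
    - (expR a * a ^+ 2 / n%:R) <= series (expmx_coeff A i j) n.+1.
  move=> n0 an; have nR0 : (0 : R) < n%:R by rewrite ltr0n.
  have powE (S : pzRingType) (x : S) : (x + 1) ^+ n =
      \sum_(0 <= k < n.+1) x ^+ k *+ 'C(n, k).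
    by rewrite exprD1n big_mkord.
  pose B := (n%:R^-1 *: A + 1) ^+ n.
  have B0 : 0 <= B i j.
    (* The diagonal entries are at least [1 - a / n], hence nonnegative by [a <= n]. *)
    have C0 k l : 0 <= (n%:R^-1 *: A + 1) k l.
      rewrite !mxE; have [->|kl] := eqVneq k l; last first.
        by rewrite addr0 mulr_ge0 ?A0// invr_ge0 ltW.
      rewrite mulrC -lerBlDr sub0r lerNl -mulNr ler_pdivrMr// mul1r.
      by apply: le_trans an; apply: le_trans (Aa1 l l); rewrite -normrN ler_norm.
    suff pow0 k i' j' : 0 <= ((n%:R^-1 *: A + 1) ^+ k) i' j' by exact: pow0.
    elim: k i' j' => [|k IH] i' j'.
      by rewrite expr0 mxE ler0n.
    by rewrite exprS -mulmxE mxE sumr_ge0// => l _; rewrite mulr_ge0.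
  have BE : B i j =
      \sum_(0 <= k < n.+1) (A ^+ k) i j * ('C(n, k)%:R / n%:R ^+ k).
    rewrite /B powE summxE; apply: eq_bigr => k _.
    by rewrite exprZmx mulmxnE mxE -mulr_natr exprVn; ring.
  have aE : (a / n%:R + 1) ^+ n =
      \sum_(0 <= k < n.+1) a ^+ k * ('C(n, k)%:R / n%:R ^+ k).
    rewrite powE; apply: eq_bigr => k _.
    by rewrite exprMn exprVn -mulr_natr; ring.
  have coef0 k : (0 : R) <= k`!%:R^-1 - 'C(n, k)%:R / n%:R ^+ k.
    rewrite subr_ge0 ler_pdivrMr ?exprn_gt0// ler_pdivlMl ?ltr0n ?fact_gt0//.
    rewrite -natrM -natrX ler_nat mulnC bin_ffact.
    exact: ffact_le_expn.
  have diff : `|series (expmx_coeff A i j) n.+1 - B i j|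
      <= series (exp_coeff a) n.+1 - (a / n%:R + 1) ^+ n.
    rewrite BE aE /series/= -!sumrB; apply: le_trans (ler_norm_sum _ _ _) _.
    apply: ler_sum => k _; rewrite -!mulrBr normrM [X in _ * X]ger0_norm//.
    rewrite ler_wpM2r//; apply: le_trans (exprmx_row_sum i k Aa).
    by rewrite (bigD1 j)//= lerDl sumr_ge0.
  have expa : series (exp_coeff a) n.+1 <= expR a.
    apply: nondecreasing_cvgn_le; last exact: is_cvg_series_exp_coeff.
    move=> x y xy; apply: nondecreasing_series => // k _ _; exact: exp_coeff_ge0.
  (* With [x = a / n], [expR x * (1 - x) <= 1] gives [expR x * (1 - x ^+ 2) <= 1 + x]. The [n]-th
     power of this and Bernoulli's inequality produce the loss [n * x ^+ 2 = a ^+ 2 / n]. *)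
  have powa : expR a - expR a * a ^+ 2 / n%:R <= (a / n%:R + 1) ^+ n.
    set x := a / n%:R.
    have x0 : 0 <= x by rewrite divr_ge0// ltW.
    have x1 : x <= 1 by rewrite ler_pdivrMr// mul1r.
    have ax : expR a = expR x ^+ n.
      by rewrite -expRM_natl /x; congr expR; field; rewrite gt_eqF.
    have step : expR x * (1 - x ^+ 2) <= x + 1.
      have := expR_ge1Dx (- x); rewrite expRN => /(ler_wpM2l (expR_ge0 x)).
      rewrite mulfV ?gt_eqF ?expR_gt0// => ex.
      have -> : expR x * (1 - x ^+ 2) = expR x * (1 + - x) * (1 + x) by ring.
      by rewrite (addrC x 1) -[leRHS]mul1r ler_wpM2r// addr_ge0.
    have bern k : 1 - k%:R * x ^+ 2 <= (1 - x ^+ 2) ^+ k.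
      have xx1 : x ^+ 2 <= 1 by rewrite expr_le1.
      have xx0 : 0 <= x ^+ 2 by rewrite exprn_ge0.
      elim: k => [|k IH]; first by rewrite expr0 mul0r subr0.
      rewrite (exprSr _ k).
      apply: (@le_trans _ _ ((1 - k%:R * x ^+ 2) * (1 - x ^+ 2))); last first.
        by rewrite ler_wpM2r// subr_ge0.
      rewrite -natr1.
      have : 0 <= k%:R * (x ^+ 2 * x ^+ 2) by rewrite !mulr_ge0.
      by move: (k%:R) (x ^+ 2) => u y; lra.
    have -> : expR a - expR a * a ^+ 2 / n%:R = expR a * (1 - n%:R * x ^+ 2).
      by rewrite /x; field; rewrite gt_eqF.
    apply: (@le_trans _ _ ((expR x * (1 - x ^+ 2)) ^+ n)).
      by rewrite [(_ * (1 - _)) ^+ n]exprMn -ax ler_wpM2l ?expR_ge0.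
    rewrite lerXn2r// nnegrE ?addr_ge0// mulr_ge0 ?expR_ge0//.
    by rewrite subr_ge0 expr_le1.
  move: diff; rewrite ler_norml => /andP[].
  move: B0 expa powa; lra.
rewrite -/(expmx_coeff A i j).
have cS : series (expmx_coeff A i j) n.+1 @[n --> \oo] -->
    limn (series (expmx_coeff A i j)).
  by rewrite (cvg_shiftS (series _)); exact: is_cvg_expmx.
have c0 : - (expR a * a ^+ 2 / n%:R) @[n --> \oo] --> (0 : R).
  rewrite -oppr0 -(mulr0 (expR a * a ^+ 2)); apply: cvgN; apply: cvgM.
    exact: cvg_cst.
  apply/cvgrPdist_le => e' e'0; near=> n.
  have n0 : (0 : R) < n%:R by near: n; exact: nbhs_infty_gtr.
  rewrite sub0r normrN ger0_norm ?invr_ge0 ?ler0n//.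
  rewrite invf_ple// ?posrE//; near: n.
  exact: nbhs_infty_ger.
rewrite -(cvg_lim _ c0)// -(cvg_lim _ cS)//.
apply: ler_lim; [exact: cvgP c0|exact: cvgP cS|].
near=> n; apply: lower; first by near: n; exact: nbhs_infty_gt.
near: n; exact: nbhs_infty_ger.
Unshelve. all: by end_near. Qed.

End TransitionMatrix.

(** * Borel measurability and the Wiener law *)

Section MatrixNorm.
Context (R : realType) (m n : nat).
Implicit Types (x : 'M[R]_(m, n)) (e : R).

Lemma ler_mx_entry x i j : `|x i j| <= `|x|.
Proof.
by rewrite [leRHS]/Num.norm/= mx_normrE; apply/bigmax_geP; right; exists (i, j).
Qed.

Lemma mx_norm_le x e : 0 <= e -> (forall i j, `|x i j| <= e) -> `|x| <= e.
Proof.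
move=> e0 xe; rewrite [leLHS]/Num.norm/= mx_normrE.
by apply/bigmax_leP; split => // -[i j] _ /=.
Qed.

End MatrixNorm.

Section BorelMeasurability.
Context (R : realType).

Lemma open_measurable_mx m n (A : set 'M[R]_(m, n)) : open A -> measurable A.
Proof. by move=> oA; exact: sub_sigma_algebra. Qed.

Lemma closed_measurable_mx m n (A : set 'M[R]_(m, n)) :
  closed A -> measurable A.
Proof.
by move=> /closed_openC/open_measurable_mx/measurableC; rewrite setCK.
Qed.

Lemma compact_measurable_mx m n (A : set 'M[R]_(m, n)) :
  compact A -> measurable A.
Proof.
move=> /compact_closed cA; apply: closed_measurable_mx; apply: cA.
exact: norm_hausdorff.
Qed.

Lemma continuous_measurable_mx m n (f : 'M[R]_(m, n) -> R) :
  continuous f -> measurable_fun [set: 'M[R]_(m, n)] f.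
Proof.
move=> /continuousP cf; apply: (measurability _ (RGenOpens.measurableE R)).
move=> _ [_ [a [b ->] <-]]; rewrite setTI; apply: open_measurable_mx.
exact/cf/interval_open.
Qed.

Lemma measurable_coord m n i j :
  measurable_fun [set: 'M[R]_(m, n)] (fun x => x i j : R).
Proof. by apply: continuous_measurable_mx => x; exact: coord_continuous. Qed.

(* Open sets are countable unions of cubes with rational centers. *)
Lemma measurable_fun_coord disp (T : measurableType disp) d (f : T -> 'rV[R]_d) :
  (forall k, measurable_fun [set: T] (fun t => f t 0 k)) ->
  measurable_fun [set: T] f.
Proof.
move=> mf; apply: (@measurability _ _ _ _ _ _ (@open 'rV[R]_d)) => //.
move=> _ [V oV <-]; rewrite setTI.
pose cube (c : 'rV[rat]_d * nat) : set 'rV[R]_d :=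
  [set y | forall k, `|ratr (c.1 0 k) - y 0 k| < c.2.+1%:R^-1].
pose F (c : 'rV[rat]_d * nat) : set T :=
  [set t | cube c `<=` V /\ cube c (f t)].
have -> : f @^-1` V = \bigcup_c F c.
  apply/seteqP; split => [t /= Vft|t [c _ [cV fc]]]; last exact: cV.
  have /nbhs_ballP[e /= e0 eV] : nbhs (f t) V by rewrite nbhsE; exists V.
  (* A cube of half-side [1 / (n + 1)] containing [f t] stays within [2 / (n + 1) < e] of it. *)
  pose n := Num.truncn (2 / e).
  have n2 : 2 * n.+1%:R^-1 < e.
    have := truncnS_gt (2 / e); rewrite -/n ltr_pdivrMr// => ne.
    by rewrite ltr_pdivrMr ?ltr0n// mulrC.
  have n0 : (0 : R) < n.+1%:R^-1 by rewrite invr_gt0 ltr0n.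
  have /choice[w wP] : forall k, exists q : rat,
      `|ratr q - f t 0 k| < n.+1%:R^-1.
    move: (n.+1%:R^-1) n0 => u u0 k.
    have /rat_in_itvoo[q] : f t 0 k - u < f t 0 k + u by lra.
    rewrite in_itv/= => /andP[q1 q2]; exists q.
    by rewrite ltr_norml; apply/andP; split; lra.
  exists (\row_k w k, n) => //; split; last by move=> k; rewrite mxE.
  move=> y yc; apply: eV; split => // i k; rewrite ord1.
  have := yc k; rewrite mxE/= => yk; have := wP k; rewrite distrC => wk.
  rewrite /ball/=; apply: lt_trans n2.
  have -> : f t 0 k - y 0 k = (f t 0 k - ratr (w k)) + (ratr (w k) - y 0 k).
    by rewrite addrA subrK.
  apply: le_lt_trans (ler_normD _ _) _.
  by move: (_^-1) yk wk => u; lra.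
apply: countable_bigcupT_measurable => // c.
have [cV|cV] := pselect (cube c `<=` V); last first.
  by rewrite (_ : F c = set0)//; apply/seteqP; split => t // -[].
rewrite (_ : F c = \bigcap_(k in [set: 'I_d])
   ((fun t => f t 0 k) @^-1` (ball (ratr (c.1 0 k) : R^o) c.2.+1%:R^-1))).
  apply: fin_bigcap_measurable => // k _.
  rewrite -[X in measurable X]setTI; apply: mf => //.
  exact: measurable_ball.
apply/seteqP; split => [t [_ tc] k _|t tc]; first exact: tc.
by split => // k; exact: tc.
Qed.

Lemma closed_ball0 d (r : R) : closed [set w : 'rV[R]_d | `|w| <= r].
Proof.
rewrite (_ : [set _ | _] = @Num.norm R _ @^-1` [set x | x <= r])//.
by apply: preimage_closed; [move=> x _; exact: norm_continuous|exact: closed_le].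
Qed.

Lemma closed_ball0_measurable d (r : R) :
  measurable [set w : 'rV[R]_d | `|w| <= r].
Proof. by apply: closed_measurable_mx; exact: closed_ball0. Qed.

End BorelMeasurability.

(** * The law of the Wiener increment *)

Section WienerLaw.
Context (R : realType).

(** [rV_prod] is a bare set function; here it is identified with a bundled probability, at each
    dimension the image of a product probability under a measurable gluing map. *)
Lemma rV_prodP (P : probability (measurableTypeR R) R) d :
  exists Q : probability 'rV[R]_d R, @rV_prod R P d = Q.
Proof.
elim: d => [|d [Q QE]].
  by exists (\d_(0 : 'rV[R]_0)).
pose g (y : measurableTypeR R * 'rV[R]_d) : 'rV[R]_(1 + d) :=
  row_mx (y.1 : R)%:M y.2.
have mg : measurable_fun setT g.
  apply: measurable_fun_coord => k.
  have [j kE|j kE] := splitP k.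
    rewrite (_ : (fun _ => _) = fst); first exact: measurable_fst.
    apply/funext => y; rewrite /g (_ : k = lshift d j); last exact: val_inj.
    by rewrite row_mxEl !ord1 mxE eqxx mulr1n.
  rewrite (_ : (fun _ => _) = (fun x : 'rV[R]_d => x 0 j) \o snd).
    apply: measurableT_comp; [exact: measurable_coord|exact: measurable_snd].
  apply/funext => y; rewrite /g (_ : k = rshift 1 j); last exact: val_inj.
  by rewrite row_mxEr.
pose gM : {mfun (measurableTypeR R * 'rV[R]_d)%type >-> 'rV[R]_(1 + d)} :=
  HB.pack g (isMeasurableFun.Build _ _ _ _ g mg).
exists (distribution (P \x Q)%E gM).
by rewrite /= QE.
Qed.

Lemma wiener_lawP d (h : R) :
  exists Q : probability 'rV[R]_d R, @wiener_law R d h = Q.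
Proof. exact: rV_prodP. Qed.

(** Continuity of [Q] along the increasing balls of radius [n + 1], which exhaust the space. *)
Lemma probability_ball_tight d (Q : probability 'rV[R]_d R) (e : R) : 0 < e ->
  exists2 r : R, 0 < r & fine (Q (~` [set w | `|w| <= r])) <= e.
Proof.
move=> e0.
pose F n := [set w : 'rV[R]_d | `|w| <= n.+1%:R].
have mF n : measurable (F n) by exact: closed_ball0_measurable.
have cvF : Q (F n) @[n --> \oo] --> 1%E.
  rewrite -(probability_setT Q) (_ : [set: _] = \bigcup_n F n).
    apply: nondecreasing_cvg_mu => //; first exact: bigcupT_measurable.
    move=> a b ab; apply/subsetPset => w /= /le_trans; apply.
    by rewrite ler_nat.
  apply/seteqP; split => // w _; exists (Num.truncn `|w|) => //=.
  exact/ltW/truncnS_gt.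
have {}cvF : Q (~` F n) @[n --> \oo] --> 0%E.
  rewrite (_ : (fun _ => _) = (fun n => 1 - Q (F n))%E); last first.
    by apply/funext => n; rewrite probability_setC.
  rewrite (_ : 0%E = 1 - 1 :> \bar R)%E; last by rewrite -EFinB subrr.
  apply: cvgeB => //; exact: cvg_cst.
move/fine_cvgP: cvF => [_ /cvgrPdist_le /(_ _ e0)[n _ /(_ n (leqnn n))]].
rewrite /= sub0r normrN => nP; exists n.+1%:R => //.
exact: le_trans (ler_norm _) nP.
Qed.

End WienerLaw.

(** * Integrals of non-measurable functions *)

Section Integrals.
Context disp (T : measurableType disp) (R : realType).
Implicit Types (mu : {measure set T -> \bar R}).

(* The integral of a nonnegative function is a supremum over the simple
   functions below it, hence monotone even on non-measurable functions. *)
Lemma le_integral_pointwise mu (D : set T) (f g : T -> \bar R) :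
  (forall x, f x <= g x)%E ->
  (\int[mu]_(x in D) f x <= \int[mu]_(x in D) g x)%E.
Proof.
move=> fg.
have fgD x : ((f \_ D) x <= (g \_ D) x)%E by rewrite /patch; case: ifP.
rewrite /integral; apply: leeB; apply: ereal_sup_le => _ [h hf <-];
  exists h => // x; apply: le_trans (hf x) _.
  by rewrite !funeposE ge_max !le_max fgD lexx orbT.
by rewrite !funenegE ge_max !le_max leeN2 [X in X || _]fgD lexx orbT.
Qed.

Lemma bounded_integrable mu (f : T -> R) (C : R) : (mu setT < +oo)%E ->
  measurable_fun setT f -> (forall x, `|f x| <= C) ->
  mu.-integrable setT (EFin \o f).
Proof.
move=> mu1 mf fC.
apply: measurable_bounded_integrable => //.
exists C; split; first exact: num_real.
by move=> M CM x _; exact: le_trans (fC x) (ltW CM).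
Qed.

(** [F] may be non-measurable: it is squeezed between the integrable functions [V - G] and [V + G],
    where [G] is [e] plus [C] times the indicator of the complement of [B]. *)
Lemma integral_close mu (F V : T -> R) (B : set T) (a C0 C e : R) :
    mu setT = a%:E -> measurable_fun setT V -> (forall x, `|V x| <= C0) ->
    measurable B -> 0 <= C -> 0 <= e ->
    (forall x, B x -> `|F x - V x| <= e) -> (forall x, `|F x - V x| <= C) ->
  `|fine (\int[mu]_x (F x)%:E) - fine (\int[mu]_x (V x)%:E)|
  <= e * a + C * fine (mu (~` B)).
Proof.
move=> mua mV VC mB C0_ge0 e0 FVe FVC.
have mfin : (mu setT < +oo)%E by rewrite mua ltry.
have iV := bounded_integrable mfin mV VC.
have muB : mu (~` B) = (fine (mu (~` B)))%:E.
  rewrite fineK// ge0_fin_numE//; apply: le_lt_trans mfin.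
  by apply: le_measure; rewrite ?inE//; exact: measurableC.
pose G x := e + C * \1_(~` B) x.
have mG : measurable_fun setT G.
  apply: measurable_funD; first exact: measurable_cst.
  apply: measurable_funM; first exact: measurable_cst.
  by apply: measurable_indic; exact: measurableC.
have iG : mu.-integrable setT (EFin \o G).
  apply: (bounded_integrable mfin mG (C := e + C)) => x.
  rewrite ger0_norm; last by rewrite addr_ge0// mulr_ge0.
  by rewrite lerD2l ler_piMr// indicE; case: (_ \in _).
have intG : (\int[mu]_x (G x)%:E = (e * a + C * fine (mu (~` B)))%:E)%E.
  rewrite (_ : (fun x => (G x)%:E) = (fun x => e%:E + C%:E * (\1_(~` B) x)%:E)%E)//.
  rewrite ge0_integralD//=; last first.
  - apply: measurable_funeM; apply/measurable_EFinP.
    by apply: measurable_indic; exact: measurableC.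
  - by move=> x _; rewrite mule_ge0.
  rewrite integral_cst// ge0_integralZl//=; last first.
    apply/measurable_EFinP.
    by apply: measurable_indic; exact: measurableC.
  rewrite integral_indic//; last exact: measurableC.
  by rewrite setIT [mu setT]mua muB.
have FG x : V x - G x <= F x <= V x + G x.
  have [xB|xB] := pselect (B x).
    have := FVe x xB; rewrite /G indicE memNset ?mulr0 ?addr0; last by apply.
    by rewrite ler_distl.
  have := FVC x; rewrite /G indicE mem_set// mulr1 ler_distl => /andP[h1 h2].
  by apply/andP; split; move: e0 h1 h2; lra.
have lo : (\int[mu]_x (V x)%:E - \int[mu]_x (G x)%:E <= \int[mu]_x (F x)%:E)%E.
  rewrite -integralB//; apply: le_integral_pointwise => x.
  by rewrite -EFinB lee_fin; have /andP[] := FG x.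
have hi : (\int[mu]_x (F x)%:E <= \int[mu]_x (V x)%:E + \int[mu]_x (G x)%:E)%E.
  rewrite -integralD//; apply: le_integral_pointwise => x.
  by rewrite -EFinD lee_fin; have /andP[] := FG x.
have Vfin := integrable_fin_num measurableT iV.
move: lo hi; rewrite intG -(fineK Vfin) -EFinB -EFinD.
(* The finite bounds on both sides exclude infinite values, on which [fine] would return the default
   [0]. *)
case: (\int[mu]_x (F x)%:E)%E => [r| |]//.
by rewrite !lee_fin /= ler_distl => h1 h2; apply/andP; split.
Qed.

(** Scaling is applied to the positive and negative parts; both have finite integrals, so the factor
    distributes over their difference. *)
Lemma integral_mscale_bounded mu (k : {nonneg R}) (V : T -> R) (C : R) :
    (mu setT < +oo)%E -> measurable_fun setT V -> (forall x, `|V x| <= C) ->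
  fine (\int[mscale k mu]_x (V x)%:E) = k%:num * fine (\int[mu]_x (V x)%:E).
Proof.
move=> mfin mV VC.
have iV := bounded_integrable mfin mV VC.
have mV' : measurable_fun setT (EFin \o V) by exact/measurable_EFinP.
have Vfin := integrable_fin_num measurableT iV.
have /andP[Vp Vn] : ((\int[mu]_x (EFin \o V)^\+ x)%E \is a fin_num) &&
    ((\int[mu]_x (EFin \o V)^\- x)%E \is a fin_num).
  by rewrite -fin_numB -integralE.
have mp := measurable_funepos mV'; have mn := measurable_funeneg mV'.
have pE := ge0_integral_mscale mu measurableT k mp (fun x _ => funepos_ge0 _ x).
have nE := ge0_integral_mscale mu measurableT k mn (fun x _ => funeneg_ge0 _ x).
transitivity (fine ((k%:num)%:E * \int[mu]_x (EFin \o V) x)%E); last first.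
  by rewrite (fineM _ Vfin).
have mE := integralE (mscale k mu) setT (EFin \o V).
apply: (etrans (congr1 fine mE)); rewrite pE nE -muleBr//.
  by congr (fine (_ * _)%E); exact: esym (integralE mu setT (EFin \o V)).
by rewrite fin_num_adde_defr// fin_numN.
Qed.

End Integrals.

Section Pushforward.
Context d1 d2 (X : measurableType d1) (Y : measurableType d2) (R : realType).

(** Packages [pushforward] with its measure structure, as an equation to rewrite with. *)
Lemma pushforwardP (mu : {measure set X -> \bar R}) (phi : X -> Y) :
    measurable_fun setT phi ->
  exists nu : {measure set Y -> \bar R}, pushforward mu phi = nu.
Proof.
move=> mphi.
by exists (measure_function_pushforward__canonical__measure_function_Measure mu mphi).
Qed.

(** A change of variables brings both integrals to the noise space, where [integral_close] applies
    with the trivial bound [2 * C] outside [S]. *)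
Lemma pushforward_close (mu : {measure set X -> \bar R}) (phi psi : X -> Y)
    (V : Y -> R) (S : set X) (a C e : R) :
    mu setT = a%:E -> measurable_fun setT phi -> measurable_fun setT psi ->
    measurable_fun setT V -> (forall y, `|V y| <= C) -> measurable S ->
    0 <= C -> 0 <= e ->
    (forall x, S x -> `|V (phi x) - V (psi x)| <= e) ->
  `|fine (\int[pushforward mu phi]_y (V y)%:E)
    - fine (\int[pushforward mu psi]_y (V y)%:E)|
  <= e * a + 2 * C * fine (mu (~` S)).
Proof.
move=> mua mphi mpsi mV VC mS C0 e0 Ve.
have mfin : (mu setT < +oo)%E by rewrite mua ltry.
have push chi : measurable_fun setT chi ->
    (\int[pushforward mu chi]_y (V y)%:E = \int[mu]_x (V (chi x))%:E)%E.
  move=> mchi.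
  rewrite integral_pushforward//; first exact/measurable_EFinP.
  apply: (bounded_integrable mfin (C := C)); last by move=> x; exact: VC.
  exact: measurableT_comp.
rewrite !push//.
apply: (@integral_close _ _ _ mu (V \o phi) (V \o psi) S a C (2 * C) e) => //.
- exact: measurableT_comp.
- by move=> x; exact: VC.
- by rewrite mulr_ge0.
- move=> x; apply: le_trans (ler_normB _ _) _.
  by rewrite mulrDl mul1r lerD// VC.
Qed.

End Pushforward.

Import HBNNSimple.

(** The integral sees a set function only through level sets of simple functions, which are
    measurable. This transfers results on measures to the kernels, which are bare set functions. *)
Lemma eq_setfun_integral disp (T : measurableType disp) (R : realType)
    (m1 m2 : set T -> \bar R) (f : T -> \bar R) :
    (forall B, measurable B -> m1 B = m2 B) ->
  (\int[m1]_x f x = \int[m2]_x f x)%E.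
Proof.
move=> m12; rewrite /integral.
have E (h : {nnsfun T >-> R}) : sintegral m1 h = sintegral m2 h.
  rewrite /sintegral; apply: eq_fsbigr => r _; congr (_ * _)%E.
  by apply: m12; exact: measurable_funPTI.
by congr (ereal_sup _ - ereal_sup _)%E; apply/seteqP; split => _ [h hf <-];
  exists h.
Qed.

(** * Integrals against transition kernels *)

Section KernelIntegrals.
Context (R : realType) (d N : nat) (U : Type).
Implicit Types (P : kernel_fun R d N U) (F V : 'rV[R]_d -> 'I_N -> R).
Implicit Types (x y : 'rV[R]_d) (i j : 'I_N) (u : U) (B : set 'rV[R]_d).

(** Agreement with measures is asked on measurable sets only; the total mass [1] is shared among the
    regimes [j]. *)
Definition stochastic (p : 'I_N -> set 'rV[R]_d -> \bar R) : Prop :=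
  exists mu : 'I_N -> {measure set 'rV[R]_d -> \bar R}, exists a : 'I_N -> R,
  [/\ forall j B, measurable B -> p j B = mu j B,
      forall j, mu j setT = (a j)%:E & \sum_j a j = 1].

Lemma kernel_int_close P F V x i u B (C0 C e : R) :
    stochastic (P x i u) -> (forall j, measurable_fun setT (V^~ j)) ->
    (forall y j, `|V y j| <= C0) -> measurable B -> 0 <= C -> 0 <= e ->
    (forall y j, B y -> `|F y j - V y j| <= e) ->
    (forall y j, `|F y j - V y j| <= C) ->
  `|kernel_int P F x i u - kernel_int P V x i u|
  <= e + C * \sum_j fine (P x i u j (~` B)).
Proof.
move=> [mu [a [Pmu mua a1]]] mV VC mB C_ge0 e0 FVe FVC.
rewrite /kernel_int -sumrB; apply: le_trans (ler_norm_sum _ _ _) _.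
rewrite -[e in leRHS]mulr1 -a1 !mulr_sumr -big_split/=; apply: ler_sum => j _.
rewrite !(eq_setfun_integral _ (Pmu j)) Pmu; last exact: measurableC.
apply: (@integral_close _ _ _ _ (F^~ j) (V^~ j) B (a j) C0) => // y.
exact: FVe.
Qed.

Lemma kernel_int_bounded P F x i u (C : R) : stochastic (P x i u) -> 0 <= C ->
  (forall y j, `|F y j| <= C) -> `|kernel_int P F x i u| <= C.
Proof.
move=> sP C0 FC.
(* Comparison with the zero function on the whole space, so that the term for the complement
   vanishes. *)
have := @kernel_int_close P F (fun _ _ => 0) x i u setT 0 C C sP.
rewrite [X in _ - X]big1 => [|j _]; last first.
  case: sP => mu [a [Pmu _ _]].
  by rewrite (eq_setfun_integral _ (Pmu j)) integral0_eq.
have sum0 : \sum_j fine (P x i u j (~` setT)) = 0.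
  apply: big1 => j _; case: sP => mu [a [Pmu _ _]].
  by rewrite Pmu; [rewrite setCT measure0|exact: measurableC].
rewrite subr0 sum0 mulr0 addr0; apply => //.
- by move=> y j; rewrite normr0.
- by move=> y j _; rewrite subr0.
- by move=> y j; rewrite subr0.
Qed.

Context disp (T : measurableType disp) (W : probability T R).
Implicit Types (a : 'I_N -> R) (phi : T -> 'rV[R]_d).

(* [p j] is the law of [phi w] on the event that an index drawn independently of
   [w] with weights [a] is [j]. *)
Definition noise_repr (p : 'I_N -> set 'rV[R]_d -> \bar R) a phi : Prop :=
  [/\ measurable_fun setT phi, forall j, 0 <= a j, \sum_j a j = 1 &
      forall j B, measurable B -> p j B = ((a j)%:E * W (phi @^-1` B))%E].

Lemma noise_stochastic p a phi : noise_repr p a phi -> stochastic p.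
Proof.
move=> [mphi a0 a1 pE].
have /choice[mu muE] : forall j, exists mu : {measure set 'rV[R]_d -> \bar R},
    pushforward (mscale (NngNum (a0 j)) W) phi = mu.
  by move=> j; exact: pushforwardP.
exists mu, a; split => // j => [B mB|]; first by rewrite -muE pE.
by rewrite -muE /pushforward/mscale/= preimage_setT probability_setT mule1.
Qed.

Lemma noise_integral p a phi j (f : 'rV[R]_d -> R) (C : R) :
    noise_repr p a phi -> measurable_fun setT f -> (forall y, `|f y| <= C) ->
  fine (\int[p j]_y (f y)%:E)
  = a j * fine (\int[pushforward W phi]_y (f y)%:E).
Proof.
move=> [mphi a0 a1 pE] mf fC.
have [nu nuE] := pushforwardP W mphi.
rewrite (@eq_setfun_integral _ _ _ _ (mscale (NngNum (a0 j)) nu)); last first.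
  by move=> B mB; rewrite pE// /mscale/= -nuE.
rewrite (integral_mscale_bounded _ _ mf fC) ?nuE//.
have -> : nu setT = 1%E by rewrite -nuE; exact: (probability_setT W).
by rewrite ltry.
Qed.

Lemma noise_integral_le phi (f : 'rV[R]_d -> R) (C : R) :
    measurable_fun setT phi -> measurable_fun setT f -> 0 <= C ->
    (forall y, `|f y| <= C) ->
  `|fine (\int[pushforward W phi]_y (f y)%:E)| <= C.
Proof.
move=> mphi mf C0 fC.
have [nu nuE] := pushforwardP W mphi; rewrite nuE.
have nu1 : nu setT = 1%:E by rewrite -nuE; exact: (probability_setT W).
have := @integral_close _ _ _ nu f (fun=> 0) setT 1 0 C C nu1.
rewrite [X in _ - X](_ : _ = 0); last by rewrite integral0_eq.
rewrite subr0 setCT measure0 mulr0 addr0 mulr1; apply => //.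
- by move=> y; rewrite normr0.
- by move=> y _; rewrite subr0.
- by move=> y; rewrite subr0.
Qed.

(** Coupling: both laws are driven by the same noise [w]. The errors come from the weights, from the
    two images of a noise in [S], and from the exceptional noises outside [S]. *)
Lemma noise_close P Q V a a' phi psi x x' i i' u u' (S : set T) (C e : R) :
    noise_repr (P x i u) a phi -> noise_repr (Q x' i' u') a' psi ->
    (forall j, measurable_fun setT (V^~ j)) -> 0 <= C -> 0 <= e ->
    (forall y j, `|V y j| <= C) -> measurable S ->
    (forall w j, S w -> `|V (phi w) j - V (psi w) j| <= e) ->
  `|kernel_int P V x i u - kernel_int Q V x' i' u'|
  <= C * (\sum_j `|a j - a' j|) + e + 2 * C * fine (W (~` S)).
Proof.
move=> PE QE mV C0 e0 VC mS Ve.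
have [mphi _ _ _] := PE; have [mpsi a'0 a'1 _] := QE.
rewrite /kernel_int -sumrB; apply: le_trans (ler_norm_sum _ _ _) _.
apply: (@le_trans _ _ (\sum_j
    (C * `|a j - a' j| + (e + 2 * C * fine (W (~` S))) * a' j))); last first.
  by rewrite big_split/= -!mulr_sumr a'1 mulr1 addrA.
apply: ler_sum => j _.
have VjC y : `|V y j| <= C by exact: VC.
rewrite (noise_integral _ PE (mV j) VjC) (noise_integral _ QE (mV j) VjC).
set I := fine _; set I' := fine _.
have -> : a j * I - a' j * I' = I * (a j - a' j) + (I - I') * a' j by ring.
apply: le_trans (ler_normD _ _) _; rewrite !normrM (ger0_norm (a'0 j)).
rewrite lerD// ler_wpM2r//.
  exact: noise_integral_le.
have := @pushforward_close _ _ _ _ _ W phi psi (V^~ j) S 1 C e.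
rewrite mulr1; apply => //; first exact: probability_setT.
by move=> w; exact: Ve.
Qed.

End KernelIntegrals.

(** * The kernels of the two models *)

Section Mixture.
Context (R : realType) (d N : nat) (disp : measure_display).
Context (T : measurableType disp) (W : probability T R).
Context (mu : probability 'rV[R]_d R) (D : set 'rV[R]_d).

(** The probability is the measure of the section at [z] of a jointly measurable set. *)
Lemma measurable_fun_noise_law (phi : 'rV[R]_d -> T -> 'rV[R]_d) B :
    measurable_fun setT (fun p : 'rV[R]_d * T => phi p.1 p.2) -> measurable B ->
  measurable_fun setT (fun z => W (phi z @^-1` B)).
Proof.
move=> mphi mB.
pose E := (fun p : 'rV[R]_d * T => phi p.1 p.2) @^-1` B.
have mE : measurable E by rewrite -[E]setTI; exact: mphi.
have := measurable_fun_xsection W mE.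
rewrite (_ : (_ \o _) = (fun z => W (phi z @^-1` B)))//.
apply/funext => z /=; congr (W _); apply/seteqP; split => w.
  by rewrite xsectionE.
by rewrite xsectionE.
Qed.

(** Handles the kernel at the pseudo-state, an average over starting points: countable additivity
    and total mass follow from exchanging sums of nonnegative functions with the integral over
    [z]. *)
Lemma mixture_stochastic (p : 'rV[R]_d -> 'I_N -> set 'rV[R]_d -> \bar R)
    (a : 'rV[R]_d -> 'I_N -> R) (phi : 'rV[R]_d -> T -> 'rV[R]_d) :
    measurable D -> mu D = 1%E -> (forall z, noise_repr W (p z) (a z) (phi z)) ->
    (forall j, measurable_fun setT (a^~ j)) ->
    measurable_fun setT (fun q : 'rV[R]_d * T => phi q.1 q.2) ->
  stochastic (fun j B => \int[mu]_(z in D) p z j B)%E.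
Proof.
move=> mD mu1 pE ma mphi.
have a0 z j : 0 <= a z j by have [] := pE z.
(* For fixed [z] the integrand is a measure in [B], whence its nonnegativity and additivity. *)
have kP z j : exists k : {measure set 'rV[R]_d -> \bar R},
    forall B, k B = ((a z j)%:E * W (phi z @^-1` B))%E.
  have [mphiz _ _ _] := pE z.
  have [k kE] := pushforwardP (mscale (NngNum (a0 z j)) W) mphiz.
  by exists k => B; rewrite -kE.
pose nu j B := (\int[mu]_(z in D) ((a z j)%:E * W (phi z @^-1` B)))%E.
have mk j B : measurable B ->
    measurable_fun D (fun z => (a z j)%:E * W (phi z @^-1` B))%E.
  move=> mB; apply: (@measurable_funS _ _ _ _ setT) => //.
  apply: emeasurable_funM; first by apply/measurable_EFinP; exact: ma.
  exact: measurable_fun_noise_law.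
have k_ge0 z j B : (0 <= (a z j)%:E * W (phi z @^-1` B))%E.
  by have [k <-] := kP z j.
have nu0 j : nu j set0 = 0%E.
  by rewrite /nu integral0_eq// => z _; rewrite preimage_set0 measure0 mule0.
have nu_ge0 j B : (0 <= nu j B)%E by apply: integral_ge0 => z _; exact: k_ge0.
have nu_additive j : semi_sigma_additive (nu j).
  move=> F mF tF mUF.
  rewrite [X in _ --> X](_ : _ = \sum_(n <oo) nu j (F n))%E; last first.
    rewrite -integral_nneseries//; last by move=> n; exact: mk.
    apply: eq_integral => z _; have [k kE] := kP z j.
    rewrite -kE measure_semi_bigcup//.
    by apply: eq_eseriesr => n _; rewrite kE.
  by apply/cvg_closeP; split; [exact: is_cvg_nneseries|rewrite closeE].
have /choice[nuM nuME] : forall j, exists k : {measure set 'rV[R]_d -> \bar R},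
    nu j = k.
  move=> j.
  pose k : {measure set 'rV[R]_d -> \bar R} := HB.pack (nu j)
    (isMeasure.Build _ _ _ (nu j) (nu0 j) (nu_ge0 j) (nu_additive j)).
  by exists k.
exists nuM, (fun j => fine (nu j setT)).
have nuT j : nu j setT = (\int[mu]_(z in D) (a z j)%:E)%E.
  by apply: eq_integral => z _; rewrite preimage_setT probability_setT mule1.
have ma' j : measurable_fun D (fun z => (a z j)%:E).
  apply: (@measurable_funS _ _ _ _ setT) => //; by apply/measurable_EFinP; exact: ma.
have sum1 : (\sum_j nu j setT = 1)%E.
  under eq_bigr do rewrite nuT.
  rewrite -ge0_integral_sum//; last by move=> j z _; rewrite lee_fin.
  rewrite (eq_integral (fun=> 1%E)); last first.
    by move=> z _; have [_ _ a1 _] := pE z; rewrite sumEFin a1.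
  by rewrite integral_cst// mul1e.
have nu_fin j : nu j setT \is a fin_num.
  rewrite ge0_fin_numE//; apply: (@le_lt_trans _ _ 1%E); last exact: ltry.
  by rewrite -sum1 (bigD1 j)//= leeDl// sume_ge0.
split.
- move=> j B mB; rewrite -nuME; apply: eq_integral => z _.
  by have [_ _ _ ->] := pE z.
- by move=> j; rewrite -nuME fineK.
- by apply: EFin_inj; rewrite -sumEFin -sum1; apply: eq_bigr => j _; rewrite fineK.
Qed.

End Mixture.

(** * Noise representation of the Euler-Maruyama kernel and of its collapsed versions *)

Section EulerMaruyamaNoise.
Context (R : realType) (d N : nat) (U : Type).
Context (b : 'rV[R]_d -> 'I_N -> U -> 'rV[R]_d).
Context (sigma : 'rV[R]_d -> 'I_N -> 'M[R]_d) (m : 'rV[R]_d -> 'M[R]_N) (h : R).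
Context (W : probability 'rV[R]_d R).
Implicit Types (x : 'rV[R]_d) (i j : 'I_N) (u : U) (A : set 'rV[R]_d).

(** Composed with the Euler-Maruyama map, it realizes the collapsed kernel with the same noise as
    the original one. *)
Definition collapse A (Delta : 'rV[R]_d) (y : 'rV[R]_d) :=
  if y \in A then y else Delta.

Lemma measurable_collapse A Delta : measurable A ->
  measurable_fun setT (collapse A Delta).
Proof.
move=> mA; apply: measurable_fun_if => //.
  apply: (measurable_fun_bool true); rewrite setTI (_ : _ @^-1` _ = A)//.
  by apply/seteqP; split => y /=; [exact: set_mem|exact: mem_set].
Qed.

Hypothesis b_cont : forall i u, continuous (fun x => b x i u).
Hypothesis sigma_cont : forall i, continuous (fun x => sigma x i).

(** Joint measurability in state and noise is what averaging over starting points requires;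
    coordinatewise the map is a sum of products of measurable functions. *)
Lemma measurable_em_map i u : measurable_fun setT
  (fun p : 'rV[R]_d * 'rV[R]_d => em_map b sigma h p.1 i u p.2).
Proof.
apply: measurable_fun_coord => k.
have coordE : (fun p : 'rV[R]_d * 'rV[R]_d => em_map b sigma h p.1 i u p.2 0 k) =
    (fun p => p.1 0 k + h * b p.1 i u 0 k + \sum_l p.2 0 l * sigma p.1 i k l).
  apply/funext => p; rewrite /em_map !mxE; congr (_ + _).
  by apply: eq_bigr => l _; rewrite mxE.
rewrite coordE; apply: measurable_funD; first apply: measurable_funD.
- exact: (measurableT_comp (measurable_coord _ _) measurable_fst).
- apply: measurable_funM; first exact: measurable_cst.
  apply: (@measurableT_comp _ _ _ _ _ _ (fun x => b x i u 0 k)) => //.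
  apply: continuous_measurable_mx => x.
  by apply: (@continuous_comp _ _ _ (fun x => b x i u)
    (fun y : 'rV[R]_d => y 0 k)); [exact: b_cont|exact: coord_continuous].
- apply: measurable_sum => l; apply: measurable_funM.
    exact: (measurableT_comp (measurable_coord _ _) measurable_snd).
  apply: (@measurableT_comp _ _ _ _ _ _ (fun x => sigma x i k l)) => //.
  apply: continuous_measurable_mx => x.
  by apply: (@continuous_comp _ _ _ (fun x => sigma x i)
    (fun y : 'M[R]_d => y k l)); [exact: sigma_cont|exact: coord_continuous].
Qed.

Lemma measurable_em_map_noise x i u : measurable_fun setT (em_map b sigma h x i u).
Proof.
apply: (measurableT_comp (measurable_em_map i u)
  (measurable_fun_pair (measurable_cst x) (@measurable_id _ _ _))).
Qed.

Hypothesis WE : @wiener_law R d h = W.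
Hypothesis m_ge0 : forall x i j, i != j -> 0 <= m x i j.
Hypothesis m_sum0 : forall x i, \sum_j m x i j = 0.
Hypothesis h_ge0 : 0 <= h.

Let P := em_kernel b sigma m h.

Lemma em_noise_repr x i u :
  noise_repr W (P x i u) (ctmc_trans h (m x) i) (em_map b sigma h x i u).
Proof.
split.
- exact: measurable_em_map_noise.
- by move=> j; apply: ctmc_trans_ge0 => // k l; exact: m_ge0.
- exact: ctmc_trans_sum1.
- by move=> j B _; rewrite /P /em_kernel WE.
Qed.

(** The preimage of [B] under [collapse] is the part of [B] in [A], together with the complement of
    [A] exactly when [Delta] lies in [B]; the two pieces are disjoint. *)
Lemma collapsed_noise_repr A Delta x i u : measurable A ->
  noise_repr W (collapsed_kernel P A Delta x i u) (ctmc_trans h (m x) i)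
    (collapse A Delta \o em_map b sigma h x i u).
Proof.
move=> mA; have [mem a0 a1 PE] := em_noise_repr x i u.
split => //; first exact: measurableT_comp (measurable_collapse Delta mA) mem.
move=> j B mB; rewrite /collapsed_kernel !PE//; last 2 first.
- exact: measurableC.
- exact: measurableI.
set g := em_map _ _ _ _ _ _.
have mg C : measurable C -> measurable (g @^-1` C).
  by move=> mC; rewrite -[X in measurable X]setTI; exact: mem.
rewrite diracE; have [DB|DB] := boolP (Delta \in B).
  rewrite mule1 -ge0_muleDr//; congr (_ * _)%E.
  rewrite -measureU; first last.
  - by rewrite -preimage_setI -setIA setICr setI0 preimage_set0.
  - by apply: mg; exact: measurableC.
  - by apply: mg; exact: measurableI.
  congr (W _); apply/seteqP; split => w /=; rewrite /collapse.
    by move=> [[Bw Aw]|Aw]; [rewrite mem_set|rewrite memNset//; exact/set_mem].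
  by case: ifPn => [/set_mem Aw Bw|/negP Aw _]; [left|right => /mem_set].
rewrite mule0 adde0; congr (_ * W _)%E.
apply/seteqP; split => w /=; rewrite /collapse.
  by move=> [Bw Aw]; rewrite mem_set.
by case: ifPn => [/set_mem Aw Bw//|_ /mem_set]; rewrite (negbTE DB).
Qed.

Lemma cstate_stochastic A Delta (mu : probability 'rV[R]_d R) x i u :
    (forall i j, measurable_fun setT (fun z => ctmc_trans h (m z) i j)) ->
    measurable A -> mu (~` A) = 1%E ->
  stochastic (cstate_kernel P A Delta mu x i u).
Proof.
move=> ma mA mu1.
have -> : cstate_kernel P A Delta mu x i u = if x \in A
    then collapsed_kernel P A Delta x i u
    else fun j B => (\int[mu]_(z in ~` A) collapsed_kernel P A Delta z i u j B)%E.
  by apply/funext => j; apply/funext => B; rewrite /cstate_kernel; case: ifP.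
case: ifP => _.
  exact: noise_stochastic (collapsed_noise_repr Delta x i u mA).
apply: (mixture_stochastic (measurableC mA) mu1
  (fun z => collapsed_noise_repr Delta z i u mA)) => //.
exact: measurableT_comp (measurable_collapse Delta mA) (measurable_em_map i u).
Qed.

End EulerMaruyamaNoise.

(** * Uniform continuity and one-step convergence *)

Section InfBounds.
Context (R : realType) (U : Type) (u0 : U).
Implicit Types (f g : U -> R) (C e : R).

Lemma inf_abs_le f C : (forall u, `|f u| <= C) ->
  `|inf [set f u | u in [set: U]]| <= C.
Proof.
move=> fC; have hl : lbound [set f u | u in [set: U]] (- C).
  by move=> _ [u _ <-]; have := fC u; rewrite ler_norml => /andP[].
rewrite ler_norml; apply/andP; split.
  by apply: lb_le_inf => //; exists (f u0), u0.
apply: (@le_trans _ _ (f u0)); last by have := fC u0; rewrite ler_norml => /andP[].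
by apply: ge_inf; [exists (- C)|exists u0].
Qed.

(** The value of [C] does not enter the estimate: it keeps both sets bounded below, so that [inf] is
    a true infimum, while [u0] makes them nonempty. *)
Lemma inf_close f g C e : (forall u, `|f u| <= C) -> (forall u, `|g u| <= C) ->
    (forall u, `|f u - g u| <= e) ->
  `|inf [set f u | u in [set: U]] - inf [set g u | u in [set: U]]| <= e.
Proof.
have le f' g' : (forall u, `|f' u| <= C) -> (forall u, `|f' u - g' u| <= e) ->
    inf [set f' u | u in [set: U]] - e <= inf [set g' u | u in [set: U]].
  move=> fC fge; apply: lb_le_inf; first by exists (g' u0), u0.
  move=> _ [u _ <-]; have := fge u; rewrite ler_norml => /andP[_ fgu].
  apply: (@le_trans _ _ (f' u - e)); last by move: fgu; lra.
  rewrite lerD2r; apply: ge_inf; last by exists u.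
  exists (- C) => _ [v _ <-].
  by have := fC v; rewrite ler_norml => /andP[].
move=> fC gC fge.
have h1 := le f g fC fge.
have h2 : inf [set g u | u in [set: U]] - e <= inf [set f u | u in [set: U]].
  by apply: le => // u; rewrite distrC.
by rewrite ler_distl; apply/andP; split; move: h1 h2; lra.
Qed.

End InfBounds.

Section Convergence.
Context (R : realType) (d N : nat) (U : Type).
Implicit Types (x y : 'rV[R]_d) (i j : 'I_N) (u : U) (e r : R).
Implicit Types (V : 'rV[R]_d -> 'I_N -> R) (F : nat -> 'rV[R]_d -> 'I_N -> R).

Definition bounded_fun V C := 0 <= C /\ forall y j, `|V y j| <= C.

Definition unif_cont V := forall e, 0 < e -> exists2 r, 0 < r &
  forall x y i, `|x - y| <= r -> `|V x i - V y i| <= e.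

Definition cvg_loc F V := forall rho e, 0 < e -> exists n0, forall n x i,
  (n0 <= n)%N -> `|x| <= rho -> `|F n x i - V x i| <= e.

Lemma unif_cont_measurable V j : unif_cont V -> measurable_fun setT (V^~ j).
Proof.
move=> uV; apply: continuous_measurable_mx => x.
apply/(@cvgrPdist_le R R^o _ (nbhs x) (nbhs_filter x)) => e e0.
have [r r0 Vr] := uV e e0.
apply/nbhs_ballP; exists r => //= y.
by rewrite -ball_normE /= => xy; apply: Vr; exact: ltW.
Qed.

Context disp (T : measurableType disp) (W : probability T R).

(** Two changes: from [F] to [V] under [Q], which costs [C' + C] on the exceptional event, then from
    [Q] to [P] with equal weights, which costs [2 * C] there. *)
Lemma noise_close_total (P Q : kernel_fun R d N U) (F V : 'rV[R]_d -> 'I_N -> R)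
    a phi psi x i u (B : set 'rV[R]_d) (S : set T) (C C' e : R) :
    noise_repr W (P x i u) a phi -> noise_repr W (Q x i u) a psi ->
    bounded_fun V C -> bounded_fun F C' ->
    (forall j, measurable_fun setT (V^~ j)) ->
    measurable B -> measurable S -> 0 <= e ->
    (forall w, S w -> psi w = phi w /\ B (psi w)) ->
    (forall y j, B y -> `|F y j - V y j| <= e) ->
  `|kernel_int Q F x i u - kernel_int P V x i u|
  <= e + (C' + 3 * C) * fine (W (~` S)).
Proof.
move=> PE QE [C0 VC] [C'0 FC'] mV mB mS e0 Sw FVe.
have FVC y j : `|F y j - V y j| <= C' + C.
  by apply: le_trans (ler_normB _ _) _; rewrite lerD.
have C'C0 : 0 <= C' + C by rewrite addr_ge0.
have h1 := kernel_int_close (noise_stochastic QE) mV VC mB C'C0 e0 FVe FVC.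
have h2 : `|kernel_int Q V x i u - kernel_int P V x i u| <=
    C * (\sum_j `|a j - a j|) + 0 + 2 * C * fine (W (~` S)).
  apply: (noise_close QE PE) => // w j /Sw[-> _].
  by rewrite subrr normr0.
rewrite big1 in h2; last by move=> j _; rewrite subrr normr0.
rewrite mulr0 !add0r in h2.
have [mpsi a0 a1 QE'] := QE.
have mpsiB : measurable (psi @^-1` (~` B)).
  by rewrite -[X in measurable X]setTI; apply: mpsi => //; exact: measurableC.
(* A noise in [S] leads into [B], so leaving [B] requires an exceptional noise. *)
have h3 : \sum_j fine (Q x i u j (~` B)) <= fine (W (~` S)).
  have WB : fine (W (psi @^-1` (~` B))) <= fine (W (~` S)).
    apply: fine_le; rewrite ?fin_num_measure//; [exact: measurableC|].
    apply: le_measure; rewrite ?inE//; first exact: measurableC.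
    by move=> w Bw Sw'; have [_] := Sw w Sw'.
  rewrite (eq_bigr (fun j => a j * fine (W (psi @^-1` (~` B))))).
    by rewrite -mulr_suml a1 mul1r.
  move=> j _; rewrite QE'; last exact: measurableC.
  by rewrite fineM// fin_num_measure.
have -> : kernel_int Q F x i u - kernel_int P V x i u =
  (kernel_int Q F x i u - kernel_int Q V x i u) +
  (kernel_int Q V x i u - kernel_int P V x i u) by rewrite addrA subrK.
apply: le_trans (ler_normD _ _) _.
have := ler_wpM2l C'C0 h3; move: h1 h2.
move: (fine (W _)) (\sum_j _) => s t; lra.
Qed.

End Convergence.

Lemma mulmx_tr_norm_le (R : realType) d (w : 'rV[R]_d) (s : 'M[R]_d) :
  `|w *m s^T| <= d%:R * `|w| * `|s|.
Proof.
apply: mx_norm_le => [|i k]; first by rewrite !mulr_ge0.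
rewrite mxE; apply: le_trans (ler_norm_sum _ _ _) _.
apply: (@le_trans _ _ (\sum_(l < d) `|w| * `|s|)).
  apply: ler_sum => l _; rewrite normrM mxE.
  by rewrite ler_pM// ler_mx_entry.
by rewrite sumr_const card_ord -[leLHS]mulr_natl mulrA.
Qed.

(** The [+ 1] keeps the denominator positive when [k = 0]. *)
Lemma ler_mul_divD1 (R : realType) (k t e : R) : 0 <= k -> 0 <= t ->
  t <= e / (k + 1) -> k * t <= e.
Proof.
move=> k0 t0; have k1 : 0 < k + 1 by rewrite ltr_wpDl.
rewrite ler_pdivlMr// => te; apply: le_trans te; rewrite mulrC ler_wpM2l//.
by rewrite lerDl.
Qed.

(** * Estimates for the Euler-Maruyama kernel *)

Section Regularity.
Context (R : realType) (d N : nat) (U : Type).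
Context (b : 'rV[R]_d -> 'I_N -> U -> 'rV[R]_d).
Context (sigma : 'rV[R]_d -> 'I_N -> 'M[R]_d) (m : 'rV[R]_d -> 'M[R]_N) (h : R).
Context (L M : R) (L_ge0 : 0 <= L) (M_ge0 : 0 <= M) (h_ge0 : 0 <= h).
Hypothesis b_lip : forall x y i u, `|b x i u - b y i u| <= L * `|x - y|.
Hypothesis b_bound : forall x i u, `|b x i u| <= M.
Hypothesis sigma_lip : forall x y i, `|sigma x i - sigma y i| <= L * `|x - y|.
Hypothesis sigma_bound : forall x i, `|sigma x i| <= M.
Hypothesis m_lip : forall x y i j, `|m x i j - m y i j| <= L * `|x - y|.
Hypothesis m_bound : forall x i j, `|m x i j| <= M.
Implicit Types (V : 'rV[R]_d -> 'I_N -> R) (F : nat -> 'rV[R]_d -> 'I_N -> R).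
Implicit Types (C : R).
Implicit Types (x y w : 'rV[R]_d) (i j : 'I_N) (u : U) (r e rho : R).

Lemma em_map_lip x y i u w r : `|w| <= r ->
  `|em_map b sigma h x i u w - em_map b sigma h y i u w|
  <= (1 + h * L + d%:R * r * L) * `|x - y|.
Proof.
move=> wr; rewrite /em_map.
have -> : x + h *: b x i u + w *m (sigma x i)^T
    - (y + h *: b y i u + w *m (sigma y i)^T) =
    (x - y) + h *: (b x i u - b y i u) + w *m (sigma x i - sigma y i)^T.
  rewrite [(sigma x i - sigma y i)^T]raddfB mulmxBr scalerBr.
  move: (h *: b x i u) (h *: b y i u) (w *m (sigma x i)^T) (w *m (sigma y i)^T).
  by move=> p1 p2 p3 p4; apply/matrixP => k l; rewrite !mxE; ring.
apply: le_trans (ler_normD _ _) _; rewrite [leRHS]mulrDl lerD//.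
  apply: le_trans (ler_normD _ _) _; rewrite [leRHS]mulrDl mul1r lerD//.
  by rewrite normrZ ger0_norm// -mulrA ler_wpM2l.
apply: le_trans (mulmx_tr_norm_le _ _) _; rewrite -[leRHS]mulrA.
by rewrite ler_pM// ?mulr_ge0// ler_wpM2l.
Qed.

Lemma em_map_bound x i u w r rho : `|w| <= r -> `|x| <= rho ->
  `|em_map b sigma h x i u w| <= rho + h * M + d%:R * r * M.
Proof.
move=> wr xr; rewrite /em_map.
apply: le_trans (ler_normD _ _) _; rewrite lerD//.
  apply: le_trans (ler_normD _ _) _; rewrite lerD//.
  by rewrite normrZ ger0_norm// ler_wpM2l.
apply: le_trans (mulmx_tr_norm_le _ _) _.
by rewrite ler_pM// ?mulr_ge0// ler_wpM2l.
Qed.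

Lemma ctmc_coef_lip : exists2 L', 0 <= L' &
  forall x y i, \sum_j `|ctmc_trans h (m x) i j - ctmc_trans h (m y) i j|
    <= L' * `|x - y|.
Proof.
(* [N * (h * M)] bounds the row sums of [h *: m x], and [N * (h * L)] those of a difference per unit
   distance; the outer [N] comes from the sum over [j]. *)
exists (N%:R * (expR (N%:R * (h * M)) * (N%:R * (h * L)))).
  by rewrite !mulr_ge0// expR_ge0.
move=> x y i.
have rowM z k : \sum_j `|h * m z k j| <= N%:R * (h * M).
  apply: (@le_trans _ _ (\sum_(j < N) h * M)).
    by apply: ler_sum => j _; rewrite normrM ger0_norm// ler_wpM2l.
  by rewrite sumr_const card_ord -[leLHS]mulr_natl.
have rowL k : \sum_j `|h * m x k j - h * m y k j| <= N%:R * (h * L * `|x - y|).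
  apply: (@le_trans _ _ (\sum_(j < N) h * L * `|x - y|)).
    apply: ler_sum => j _.
    by rewrite -mulrBr normrM ger0_norm// -mulrA ler_wpM2l.
  by rewrite sumr_const card_ord -[leLHS]mulr_natl.
apply: (@le_trans _ _ (\sum_(j < N)
    expR (N%:R * (h * M)) * (N%:R * (h * L * `|x - y|)))).
  by apply: ler_sum => j _; apply: ctmc_trans_lip.
by rewrite sumr_const card_ord -[leLHS]mulr_natl !mulrA.
Qed.

Lemma ctmc_coef_measurable i j :
  measurable_fun setT (fun z => ctmc_trans h (m z) i j).
Proof.
have [L' L'0 L'P] := ctmc_coef_lip.
apply: (@unif_cont_measurable R d N (fun z _ => ctmc_trans h (m z) i j) j).
move=> e e0; exists (e / (L' + 1)); first by rewrite divr_gt0// ltr_wpDl.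
move=> x y _ xy; apply: (@le_trans _ _ (L' * `|x - y|)).
  apply: le_trans (L'P x y i).
  by rewrite (bigD1 j)//= lerDl sumr_ge0.
exact: ler_mul_divD1.
Qed.

Context (W : probability 'rV[R]_d R).

Let P := em_kernel b sigma m h.

Hypothesis P_repr : forall x i u,
  noise_repr W (P x i u) (ctmc_trans h (m x) i) (em_map b sigma h x i u).

Lemma kernel_int_unif_cont V C : bounded_fun V C -> unif_cont V ->
  forall e, 0 < e -> exists2 r, 0 < r & forall x y i u, `|x - y| <= r ->
    `|kernel_int P V x i u - kernel_int P V y i u| <= e.
Proof.
move=> [C0 VC] uV e e0; have e3 : 0 < e / 3 by rewrite divr_gt0.
have mV j : measurable_fun setT (V^~ j) by exact: unif_cont_measurable.
have [L' L'0 L'P] := ctmc_coef_lip.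
have C2 : 0 <= 2 * C by rewrite mulr_ge0.
(* The noise radius is fixed first, since the Lipschitz constant [k] of the Euler-Maruyama map grows
   with it. *)
have [r r0 Wr] := probability_ball_tight W (divr_gt0 e3 (ltr_wpDl C2 ltr01)).
have [s s0 Vs] := uV _ e3.
have CL' : 0 <= C * L' by rewrite mulr_ge0.
set k := 1 + h * L + d%:R * r * L.
have k0 : 0 <= k by rewrite /k !addr_ge0// !mulr_ge0// ltW.
(* The first radius brings the images of a noise in the ball within [s]; the second controls the
   transition weights. *)
exists (Num.min (s / (k + 1)) (e / 3 / (C * L' + 1))).
  by rewrite lt_min !divr_gt0// ltr_wpDl.
move=> x y i u; rewrite le_min => /andP[xy1 xy2].
have h1 := noise_close (P_repr x i u) (P_repr y i u) mV C0 (ltW e3) VC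
  (closed_ball0_measurable r).
have /h1 {}h1 : forall w j, `|w| <= r -> `|V (em_map b sigma h x i u w) j
    - V (em_map b sigma h y i u w) j| <= e / 3.
  move=> w j wr; apply: Vs; apply: le_trans (em_map_lip x y i u wr) _.
  exact: ler_mul_divD1.
apply: le_trans h1 _.
have h2 : C * (\sum_j `|ctmc_trans h (m x) i j - ctmc_trans h (m y) i j|)
    <= e / 3.
  apply: (@le_trans _ _ (C * (L' * `|x - y|))); first by rewrite ler_wpM2l.
  by rewrite mulrA; exact: ler_mul_divD1.
have h3 : 2 * C * fine (W (~` [set w | `|w| <= r])) <= e / 3.
  by apply: ler_mul_divD1 => //; exact: fine_ge0.
by move: h2 h3; lra.
Qed.

(** The map [psi] lets one statement cover the original kernel, with the identity, and the compact
    models, with [collapse]. *)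
Lemma kernel_int_cvg (Q : nat -> kernel_fun R d N U)
    (psi : nat -> 'rV[R]_d -> 'rV[R]_d) F V C C' :
    (forall rho, exists n0, forall n x, (n0 <= n)%N -> `|x| <= rho ->
       psi n x = x /\ forall i u, noise_repr W (Q n x i u)
         (ctmc_trans h (m x) i) (psi n \o em_map b sigma h x i u)) ->
    bounded_fun V C -> (forall n, bounded_fun (F n) C') -> unif_cont V ->
    cvg_loc F V ->
  forall rho e, 0 < e -> exists n0, forall n x i u, (n0 <= n)%N ->
    `|x| <= rho -> `|kernel_int (Q n) (F n) x i u - kernel_int P V x i u| <= e.
Proof.
move=> Qpsi VC FC' uV FV rho e e0; have e2 : 0 < e / 2 by rewrite divr_gt0.
have mV j : measurable_fun setT (V^~ j) by exact: unif_cont_measurable.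
have [C0 _] := VC; have [C'0 _] := FC' 0%N.
have k0 : 0 <= C' + 3 * C by rewrite addr_ge0// mulr_ge0.
have [r r0 Wr] := probability_ball_tight W (divr_gt0 e2 (ltr_wpDl k0 ltr01)).
(* Bound on the position after one step from the ball of radius [rho] under a noise of size at most
   [r]; eventually [psi n] fixes all points of that larger ball. *)
pose rho' := rho + h * M + d%:R * r * M.
have [n1 n1P] := FV rho' _ e2.
have [n2 n2P] := Qpsi rho.
have [n3 n3P] := Qpsi rho'.
exists (maxn n1 (maxn n2 n3)) => n x i u.
rewrite !geq_max => /and3P[nn1 nn2 nn3] xr.
have [_ /(_ i u) QE] := n2P n x nn2 xr.
have h1 := @noise_close_total _ _ _ _ _ _ W P (Q n) (F n) V _ _ _ x i u
  [set y | `|y| <= rho'] [set w | `|w| <= r] C C' (e / 2) (P_repr x i u) QE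
  VC (FC' n) mV (closed_ball0_measurable rho') (closed_ball0_measurable r)
  (ltW e2).
apply: le_trans (h1 _ _) _.
- move=> w wr; have emw := em_map_bound i u wr xr.
  by have [psiE _] := n3P n _ nn3 emw; rewrite /= psiE.
- by move=> y j yr; exact: n1P.
have h3 : (C' + 3 * C) * fine (W (~` [set w | `|w| <= r])) <= e / 2.
  by apply: ler_mul_divD1 => //; exact: fine_ge0.
by move: h3; lra.
Qed.

End Regularity.

(** * Dynamic programming *)

Section DynamicProgramming.
Context (R : realType) (d N K : nat) (U : Type) (u0 : U).
Implicit Types (V : 'rV[R]_d -> 'I_N -> R) (F : nat -> 'rV[R]_d -> 'I_N -> R).
Implicit Types (x y : 'rV[R]_d) (i j : 'I_N) (u : U) (rho e : R) (r : nat).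
Context (P : kernel_fun R d N U) (Q : nat -> kernel_fun R d N U).
Context (c : 'rV[R]_d -> 'I_N -> U -> R) (cT : 'rV[R]_d -> 'I_N -> R).
Context (cn : nat -> 'rV[R]_d -> 'I_N -> U -> R).
Context (cTn : nat -> 'rV[R]_d -> 'I_N -> R).
Context (v : nat -> nat -> 'rV[R]_d -> 'I_N -> U).
Context (B : R) (B_ge0 : 0 <= B).

Hypothesis P_stoch : forall x i u, stochastic (P x i u).
Hypothesis Q_stoch : forall n x i u, stochastic (Q n x i u).
Hypothesis c_bound : forall x i u, `|c x i u| <= B.
Hypothesis cT_bound : forall x i, `|cT x i| <= B.
Hypothesis cn_bound : forall n x i u, `|cn n x i u| <= B.
Hypothesis cTn_bound : forall n x i, `|cTn n x i| <= B.

Let V r := opt_to_go c cT (kernel_int P) r.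
Let Vn n r := opt_to_go (cn n) (cTn n) (kernel_int (Q n)) r.
Let J n r := cost_to_go K c cT (kernel_int P) (v n) r.
Let Jn n r := cost_to_go K (cn n) (cTn n) (kernel_int (Q n)) (v n) r.
(** Room for the terminal cost and [r] running costs, each at most [B]. *)
Let C r : R := r.+1%:R * B.

Let C_ge0 r : 0 <= C r. Proof. by rewrite mulr_ge0. Qed.

Let CS r : C r.+1 = B + C r.
Proof. by rewrite /C -[r.+2%:R]natr1 mulrDl mul1r addrC. Qed.

Let stage_bound (P' : kernel_fun R d N U) (c' : R) G x i u r :
    stochastic (P' x i u) -> `|c'| <= B -> bounded_fun G (C r) ->
  `|c' + kernel_int P' G x i u| <= C r.+1.
Proof.
move=> sP c'B [C0 FC]; apply: le_trans (ler_normD _ _) _.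
by rewrite CS lerD// kernel_int_bounded.
Qed.

Lemma opt_to_go_bounded r : bounded_fun (V r) (C r).
Proof.
elim: r => [|r IH]; first by split => // y j; rewrite /C mul1r.
by split => // y j; apply: inf_abs_le => // u; exact: stage_bound.
Qed.

Lemma opt_to_go_bounded_seq n r : bounded_fun (Vn n r) (C r).
Proof.
elim: r => [|r IH]; first by split => // y j; rewrite /C mul1r; exact: cTn_bound.
by split => // y j; apply: inf_abs_le => // u; exact: stage_bound.
Qed.

Lemma cost_to_go_bounded n r : bounded_fun (J n r) (C r).
Proof.
elim: r => [|r IH]; first by split => // y j; rewrite /C mul1r.
by split => // y j; exact: stage_bound.
Qed.

Lemma cost_to_go_bounded_seq n r : bounded_fun (Jn n r) (C r).
Proof.
elim: r => [|r IH]; first by split => // y j; rewrite /C mul1r; exact: cTn_bound.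
by split => // y j; exact: stage_bound.
Qed.

Hypothesis c_unif_cont : forall e, 0 < e -> exists2 s, 0 < s &
  forall x y i u, `|x - y| <= s -> `|c x i u - c y i u| <= e.
Hypothesis cT_unif_cont : unif_cont cT.
Hypothesis P_unif_cont : forall V C, bounded_fun V C -> unif_cont V ->
  forall e, 0 < e -> exists2 s, 0 < s & forall x y i u, `|x - y| <= s ->
    `|kernel_int P V x i u - kernel_int P V y i u| <= e.

(** The moduli of the cost and of the kernel integral are uniform in the action, so they pass to the
    infimum. *)
Lemma opt_to_go_unif_cont r : unif_cont (V r).
Proof.
elim: r => [|r IH]; first exact: cT_unif_cont.
move=> e e0; have e2 : 0 < e / 2 by rewrite divr_gt0.
have [s1 s10 cs] := c_unif_cont e2.
have [s2 s20 Ps] := P_unif_cont (opt_to_go_bounded r) IH e2.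
exists (Num.min s1 s2); first by rewrite lt_min s10.
move=> x y i; rewrite le_min => /andP[xy1 xy2].
have Vb x' u : `|c x' i u + kernel_int P (V r) x' i u| <= C r.+1.
  by apply: stage_bound => //; exact: opt_to_go_bounded.
apply: (inf_close u0 (Vb x) (Vb y)) => u.
rewrite opprD addrACA; apply: le_trans (ler_normD _ _) _.
by have := cs x y i u xy1; have := Ps x y i u xy2; rewrite -/(V r); lra.
Qed.

Hypothesis cn_cvg : forall rho, exists n0, forall n x, (n0 <= n)%N ->
  `|x| <= rho -> (forall i u, cn n x i u = c x i u) /\
                 (forall i, cTn n x i = cT x i).
Hypothesis P_cvg : forall F V C C', bounded_fun V C ->
  (forall n, bounded_fun (F n) C') -> unif_cont V -> cvg_loc F V ->
  forall rho e, 0 < e -> exists n0, forall n x i u, (n0 <= n)%N ->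
    `|x| <= rho -> `|kernel_int P (F n) x i u - kernel_int P V x i u| <= e.
Hypothesis Q_cvg : forall F V C C', bounded_fun V C ->
  (forall n, bounded_fun (F n) C') -> unif_cont V -> cvg_loc F V ->
  forall rho e, 0 < e -> exists n0, forall n x i u, (n0 <= n)%N ->
    `|x| <= rho -> `|kernel_int (Q n) (F n) x i u - kernel_int P V x i u| <= e.

(** On a fixed ball the running costs eventually coincide, so the two infima differ only through
    kernel integrals, which are close uniformly in the action. *)
Lemma opt_to_go_cvg r : cvg_loc (Vn^~ r) (V r).
Proof.
elim: r => [|r IH] rho e e0; have [n1 n1P] := cn_cvg rho.
  by exists n1 => n x i nn xr; have [_ cTE] := n1P n x nn xr;
    rewrite /Vn /V/= cTE subrr normr0 ltW.
have [n2 n2P] := Q_cvg (opt_to_go_bounded r) (opt_to_go_bounded_seq^~ r)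
  (@opt_to_go_unif_cont r) IH rho e0.
exists (maxn n1 n2) => n x i; rewrite geq_max => /andP[nn1 nn2] xr.
have [cE _] := n1P n x nn1 xr.
apply: (@inf_close _ _ u0 _ _ (C r.+1)) => u.
- by apply: stage_bound => //; exact: opt_to_go_bounded_seq.
- by apply: stage_bound => //; exact: opt_to_go_bounded.
- by rewrite cE opprD addrACA subrr add0r; exact: n2P.
Qed.

(* Over one stage, the costs of the policy in the two models differ by
   integrals of functions that both converge to the optimal value. *)
Lemma cost_to_go_cvg :
    (forall r, (r <= K)%N -> cvg_loc (Jn^~ r) (V r)) ->
  forall r, (r <= K)%N -> cvg_loc (J^~ r) (V r).
Proof.
move=> JnV; elim=> [|r IH] rK rho e e0.
  by exists 0%N => n x i _ _; rewrite subrr normr0 ltW.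
have e3 : 0 < e / 3 by rewrite divr_gt0.
have rK' := ltnW rK.
have [n1 n1P] := cn_cvg rho.
have [n2 n2P] := P_cvg (opt_to_go_bounded r) (cost_to_go_bounded^~ r)
  (@opt_to_go_unif_cont r) (IH rK') rho e3.
have [n3 n3P] := Q_cvg (opt_to_go_bounded r) (cost_to_go_bounded_seq^~ r)
  (@opt_to_go_unif_cont r) (JnV _ rK') rho e3.
have [n4 n4P] := JnV _ rK rho _ e3.
exists (maxn (maxn n1 n2) (maxn n3 n4)) => n x i.
rewrite !geq_max => /andP[/andP[nn1 nn2] /andP[nn3 nn4]] xr.
have [cE _] := n1P n x nn1 xr.
have h4 := n4P n x i nn4 xr.
set u := v n (K - r.+1) x i.
have h2 := n2P n x i u nn2 xr; have h3 := n3P n x i u nn3 xr.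
(* The running costs of [J] and [Jn] cancel: both models use the same action [u] at [x]. *)
have -> : J n r.+1 x i - V r.+1 x i =
    (kernel_int P (J n r) x i u - kernel_int P (V r) x i u)
    - (kernel_int (Q n) (Jn n r) x i u - kernel_int P (V r) x i u)
    + (Jn n r.+1 x i - V r.+1 x i).
  by rewrite /J /Jn /= cE -/u; ring.
apply: le_trans (ler_normD _ _) _.
apply: le_trans (lerD (ler_normB _ _) (lexx _)) _.
by move: h2 h3 h4; lra.
Qed.

End DynamicProgramming.

(** * Conclusion *)

Section EuclideanNorm.
Context (R : realType) (d : nat).
Implicit Types (x : 'rV[R]_d) (s : 'M[R]_d).

Lemma enorm_ge0 x : 0 <= enorm x. Proof. exact: sqrtr_ge0. Qed.

Lemma mx_norm_le_enorm x : `|x| <= enorm x.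
Proof.
apply: mx_norm_le => [|i k]; first exact: enorm_ge0.
rewrite ord1 /enorm -sqrtr_sqr ler_wsqrtr// (bigD1 k)//= lerDl.
by apply: sumr_ge0 => l _; exact: sqr_ge0.
Qed.

Lemma enorm_le_mx_norm x : enorm x <= d%:R * `|x|.
Proof.
have dx0 : 0 <= d%:R * `|x| by rewrite mulr_ge0.
rewrite -[leRHS]ger0_norm// -sqrtr_sqr ler_wsqrtr//.
apply: (@le_trans _ _ (\sum_(k < d) `|x| ^+ 2)).
  apply: ler_sum => k _; rewrite -[_ ^+ 2]ger0_norm ?sqr_ge0// normrX.
  by rewrite lerXn2r ?nnegrE// ler_mx_entry.
rewrite sumr_const card_ord -[leLHS]mulr_natl exprMn ler_wpM2r ?sqr_ge0//.
by rewrite -natrX ler_nat; case: d => // k; rewrite leq_pmulr.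
Qed.

Lemma mx_norm_le_frob s : `|s| <= frob s.
Proof.
apply: mx_norm_le => [|k l]; first exact: sqrtr_ge0.
rewrite /frob -sqrtr_sqr ler_wsqrtr// /mxtrace (bigD1 k)//=.
rewrite mxE (bigD1 l)//= mxE -expr2 -addrA lerDl addr_ge0//.
  by apply: sumr_ge0 => j _; rewrite mxE -expr2 sqr_ge0.
by apply: sumr_ge0 => j _; rewrite mxE sumr_ge0// => l' _; rewrite mxE -expr2 sqr_ge0.
Qed.

End EuclideanNorm.

Lemma sqr_le_sqrtM (R : realType) (a C t : R) : 0 <= a -> 0 <= t ->
  a ^+ 2 <= C * t ^+ 2 -> a <= Num.sqrt C * t.
Proof.
move=> a0 t0 aC; have [C0|C0] := leP 0 C.
  rewrite -(@ler_pXn2r _ 2)// ?nnegrE// ?mulr_ge0//.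
  by rewrite exprMn sqr_sqrtr.
(* For [C < 0] the square root is [0], and the hypothesis forces [a = 0]. *)
have : a ^+ 2 <= 0 by apply: le_trans aC _; rewrite nmulr_rle0// sqr_ge0.
rewrite le_eqVlt ltNge sqr_ge0 orbF sqrf_eq0 => /eqP ->.
by rewrite mulr_ge0.
Qed.

Lemma lipschitz_continuous_mx (R : realType) d m n (f : 'rV[R]_d -> 'M[R]_(m, n))
    (L : R) : 0 <= L -> (forall x y, `|f x - f y| <= L * `|x - y|) -> continuous f.
Proof.
move=> L0 fL x.
apply/(@cvgrPdist_le R _ _ (nbhs x) (nbhs_filter x)) => e e0.
apply/nbhs_ballP; exists (e / (L + 1)); first by rewrite /= divr_gt0// ltr_wpDl.
move=> y; rewrite -ball_normE /= => /ltW xy.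
by apply: le_trans (fL _ _) _; exact: ler_mul_divD1.
Qed.

(** Bounds the averaged costs at the pseudo-state. Comparison with the constants [C] and [- C] also
    excludes infinite values. *)
Lemma fine_integral_bounded disp (T : measurableType disp) (R : realType)
    (mu : probability T R) (D : set T) (g : T -> R) (C : R) :
    measurable D -> mu D = 1%E -> (forall x, `|g x| <= C) ->
  `|fine (\int[mu]_(x in D) (g x)%:E)| <= C.
Proof.
move=> mD muD gC.
have hi : (\int[mu]_(x in D) (g x)%:E <= \int[mu]_(x in D) (cst C%:E) x)%E.
  apply: le_integral_pointwise => x; rewrite lee_fin.
  exact: le_trans (ler_norm _) (gC x).
have lo : (\int[mu]_(x in D) (cst (- C)%:E) x <= \int[mu]_(x in D) (g x)%:E)%E.
  apply: le_integral_pointwise => x; rewrite lee_fin.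
  by have := gC x; rewrite ler_norml => /andP[].
have cstE k : (\int[mu]_(x in D) (cst k%:E) x = k%:E)%E.
  by rewrite integral_cst// -[RHS]mule1; congr (_ * _)%E.
move: lo hi; rewrite !cstE.
case: (\int[mu]_(x in D) (g x)%:E)%E => [r| |]//.
by rewrite !lee_fin /= ler_norml => h1 h2; apply/andP; split.
Qed.

(** Compactness of the ball: a point of [Kn k] is interior to [Kn k.+1], and the sets increase, so
    some neighbourhood of it lies in all later ones. *)
Lemma exhaustion_ball (R : realType) d (Kn : nat -> set 'rV[R]_d) :
    (forall n, Kn n `<=` (Kn n.+1)°) -> \bigcup_n Kn n = [set: 'rV[R]_d] ->
  forall rho : R, exists n0, forall n x, (n0 <= n)%N -> `|x| <= rho -> Kn n x.
Proof.
move=> Kint Kcov rho.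
have Kmono n k : (n <= k)%N -> Kn n `<=` Kn k.
  move=> nk; rewrite -(subnK nk); elim: (k - n)%N => // l IH x /IH.
  by rewrite addSn => /Kint /interior_subset.
have cB : compact [set x : 'rV[R]_d | `|x| <= rho].
  apply: bounded_closed_compact.
    exists rho; split; first exact: num_real.
    by move=> M rM x /= xr; exact: le_trans xr (ltW rM).
  exact: closed_ball0.
move/compact_near_coveringP : cB => /(_ nat \oo (fun n x => Kn n x) _) [].
  move=> x _; have [k _ Kx] : (\bigcup_n Kn n) x by rewrite Kcov.
  exists ((Kn k.+1)°, [set n | (k.+1 <= n)%N]).
    by split; [exact/nbhs_interior/Kint|exact: nbhs_infty_ge].
  by move=> [y n] /= [/interior_subset Ky kn]; exact: Kmono kn _ Ky.
move=> n0 _ n0P; exists n0 => n x nn xr.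
exact: (n0P n nn).
Qed.

Lemma sup_abs_le (R : realType) (T : Type) N (A : set T) (g : T -> 'I_N -> R)
    (e : R) : 0 <= e -> (forall x i, A x -> `|g x i| <= e) ->
  (sup_abs A g <= e%:E)%E.
Proof.
move=> e0 ge; rewrite /sup_abs ge_max lee_fin e0/=.
by apply: ge_ereal_sup => _ [[x i] /= [Ax _] <-]; rewrite lee_fin ge.
Qed.

Lemma le_sup_abs (R : realType) (T : Type) N (A : set T) (g : T -> 'I_N -> R)
    (e : R) x i : (sup_abs A g <= e%:E)%E -> A x -> `|g x i| <= e.
Proof.
move=> ge Ax; rewrite -lee_fin; apply: le_trans ge.
rewrite /sup_abs le_max; apply/orP; right.
by apply: ereal_sup_ubound; exists (x, i).
Qed.

Lemma sup_abs_cvg0 (R : realType) (T : Type) N (A : set T)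
    (g : nat -> T -> 'I_N -> R) :
    (forall e, 0 < e -> exists n0, forall n x i, (n0 <= n)%N -> A x ->
      `|g n x i| <= e) ->
  sup_abs A (g n) @[n --> \oo] --> 0%E.
Proof.
move=> gA.
have ge0 n : (0 <= sup_abs A (g n))%E by rewrite /sup_abs le_max lexx.
apply/fine_cvgP; split.
  have [n0 n0P] := gA 1 ltr01; exists n0 => // n nn.
  rewrite ge0_fin_numE//; apply: le_lt_trans (ltry 1).
  by apply: sup_abs_le => // x i; exact: n0P.
apply/cvgrPdist_le => e e0; have [n0 n0P] := gA e e0; exists n0 => // n nn.
rewrite /= sub0r normrN ger0_norm ?fine_ge0//.
have le : (sup_abs A (g n) <= e%:E)%E.
  by apply: sup_abs_le (ltW e0) _ => x i; exact: n0P.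
rewrite -lee_fin fineK// ge0_fin_numE//; exact: le_lt_trans le (ltry e).
Qed.

Theorem theorem6p7 (R : realType) (d N : nat) (U : metricType R)
    (b : 'rV[R]_d -> 'I_N -> U -> 'rV[R]_d)
    (sigma : 'rV[R]_d -> 'I_N -> 'M[R]_d)
    (m : 'rV[R]_d -> 'M[R]_N)
    (c : 'rV[R]_d -> 'I_N -> U -> R)
    (cT : 'rV[R]_d -> 'I_N -> R)
    (U_compact : compact [set: U])
    (m_ge0 : forall x i j, i != j -> 0 <= m x i j)
    (m_sum0 : forall x i, \sum_j m x i j = 0)
    (b_cont : forall i, continuous (fun y : 'rV[R]_d * U => b y.1 i y.2))
    (sigma_cont : forall i, continuous (fun x => sigma x i))
    (m_cont : forall i j, continuous (fun x => m x i j))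
    (elliptic : forall r : R, 0 < r -> exists2 C : R, 0 < C &
       forall x i (z : 'rV[R]_d), enorm x < r ->
       C^-1 * enorm z ^+ 2 <=
       \sum_(k < d) \sum_(l < d)
         (2^-1 *: (sigma x i *m (sigma x i)^T)) k l * z 0 k * z 0 l)
    (CL M2 : R) (CL_gt0 : 0 < CL) (M2_gt0 : 0 < M2)
    (lipschitz : forall x y i j u,
       enorm (b x i u - b y i u) ^+ 2 + frob (sigma x i - sigma y i) ^+ 2
         + `|m x i j - m y i j| ^+ 2 <= CL * enorm (x - y) ^+ 2)
    (bounded : forall x i j u,
       enorm (b x i u) ^+ 2 + frob (sigma x i) ^+ 2 + `|m x i j| ^+ 2 <= M2)
    (c_ge0 : forall x i u, 0 <= c x i u)
    (p : R) (p_ge2 : 2 <= p)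
    (cT_W2p : forall i, W2p_loc p (fun x => cT x i))
    (CLc M3 : R) (CLc_gt0 : 0 < CLc) (M3_gt0 : 0 < M3)
    (c_lipschitz : forall x y i u u',
       `|c x i u - c y i u'| <= CLc * (enorm (x - y) + mdist u u'))
    (cT_lipschitz : forall x y i, `|cT x i - cT y i| <= CLc * enorm (x - y))
    (cost_bounded : forall x i u, `|c x i u| + `|cT x i| <= M3)
    (T h : R) (T_gt0 : 0 < T) (h_gt0 : 0 < h)
    (Kn : nat -> set 'rV[R]_d)
    (Kn_compact : forall n, compact (Kn n))
    (Kn_int : forall n, Kn n `<=` (Kn n.+1)°)
    (Kn_cover : \bigcup_n Kn n = [set: 'rV[R]_d])
    (mu : nat -> probability 'rV[R]_d R)
    (mu_supp : forall n, mu n (~` Kn n) = 1%E)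
    (Delta : nat -> 'rV[R]_d)
    (Delta_notin : forall n, ~ Kn n (Delta n))
    (eps : nat -> R)
    (eps_gt0 : forall n, 0 < eps n)
    (eps_cvg0 : eps @ \oo --> (0 : R))
    (D : forall n, discretization (cstate (Kn n) (Delta n)))
    (f : forall n, nat -> 'I_(grid_size (D n)) -> 'I_N -> U) :
  let K := Num.truncn (T / h) in
  let ch := fun x i u => h * c x i u in
  let P := em_kernel b sigma m h in
  let Pn := fun n => cstate_kernel P (Kn n) (Delta n) (mu n) in
  let cn := fun n => cstate_cost ch (Kn n) (mu n) in
  let cTn := fun n => cstate_term cT (Kn n) (mu n) in
  let v := fun n => extend_policy (Kn n) (Delta n) (f n) in
  (forall n, fin_optimal (Pn n) (cn n) (cTn n) K (f n)) ->
  (forall n k, (k <= K)%N ->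
     (sup_abs (cstate (Kn n) (Delta n)) (fun x i =>
        (policy_cost K (cn n) (cTn n) (kernel_int (Pn n)) (v n) k x i -
        opt_value K (cn n) (cTn n) (kernel_int (Pn n)) k x i)%R)
      <= (eps n)%:E)%E) ->
  forall k, (k <= K)%N ->
  let J := fun n => policy_cost K ch cT (kernel_int P) (v n) k in
  let Jopt := opt_value K ch cT (kernel_int P) k in
  (forall A : set 'rV[R]_d, compact A ->
     sup_abs A (fun x i => J n x i - Jopt x i) @[n --> \oo] --> 0%E) /\
  (forall x i, `|J n x i - Jopt x i| @[n --> \oo] --> (0 : R)).
Proof.
move=> K ch P Pn cn cTn v _ eps_opt.
(* Stages are counted from the end, [r = K - k]. Balls suffice, since every compact set lies in
   one. *)
suff main r : (r <= K)%N -> cvg_loc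
    (fun n => cost_to_go K ch cT (kernel_int P) (v n) r)
    (opt_to_go ch cT (kernel_int P) r).
  move=> k kK J Jopt.
  have JJ : cvg_loc J Jopt by apply: main; exact: leq_subr.
  split=> [A cA|x i].
    apply: sup_abs_cvg0 => e e0.
    have [M [_ /(_ (M + 1))]] := compact_bounded cA.
    rewrite ltrDl => /(_ ltr01) AM.
    have [n0 n0P] := JJ (M + 1) e e0; exists n0 => n x i nn Ax.
    by apply: n0P => //; exact: AM.
  apply/cvgrPdist_le => e e0; have [n0 n0P] := JJ `|x| e e0; exists n0 => // n nn.
  by rewrite sub0r normrN normr_id; exact: n0P.
(* Without a regime the claim is vacuous; otherwise [i0] instantiates the joint Lipschitz and
   boundedness hypotheses. *)
have [[i0 _]|noI] := pselect (exists i : 'I_N, True); last first.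
  by move=> _ rho e _; exists 0%N => n x i; case: noI; exists i.
(* Any value of a policy shows that [U] is inhabited; the point at which the quantizer is evaluated
   is arbitrary. *)
pose u0 : U := f 0%N 0%N (quant (D 0%N) 0) i0.
have [W WE] := wiener_lawP d h.
have h0 := ltW h_gt0.
(* The roots undo the squares of the hypotheses; [d] is the price of passing from the Euclidean
   distance to the sup norm. *)
pose L := Num.sqrt CL * d%:R; pose M := Num.sqrt M2.
have L0 : 0 <= L by rewrite mulr_ge0// sqrtr_ge0.
have M0 : 0 <= M by exact: sqrtr_ge0.
have lipL a (x y : 'rV[R]_d) : 0 <= a -> a ^+ 2 <= CL * enorm (x - y) ^+ 2 ->
    a <= L * `|x - y|.
  move=> a0 /(sqr_le_sqrtM a0 (enorm_ge0 _)) /le_trans; apply.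
  by rewrite /L -mulrA ler_wpM2l ?sqrtr_ge0// enorm_le_mx_norm.
have bndM a : 0 <= a -> a ^+ 2 <= M2 -> a <= M.
  by move=> a0 aM; rewrite -(ger0_norm a0) -sqrtr_sqr ler_wsqrtr.
have b_lip x y i u : `|b x i u - b y i u| <= L * `|x - y|.
  apply: le_trans (mx_norm_le_enorm _) _; apply: lipL; first exact: enorm_ge0.
  apply: le_trans (lipschitz x y i i0 u).
  by rewrite -addrA lerDl addr_ge0// sqr_ge0.
have b_bound x i u : `|b x i u| <= M.
  apply: le_trans (mx_norm_le_enorm _) _; apply: bndM; first exact: enorm_ge0.
  by apply: le_trans (bounded x i i0 u); rewrite -addrA lerDl addr_ge0// sqr_ge0.
have s_lip x y i : `|sigma x i - sigma y i| <= L * `|x - y|.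
  apply: le_trans (mx_norm_le_frob _) _; apply: lipL; first exact: sqrtr_ge0.
  apply: le_trans (lipschitz x y i i0 u0).
  by rewrite addrAC lerDr addr_ge0// sqr_ge0.
have s_bound x i : `|sigma x i| <= M.
  apply: le_trans (mx_norm_le_frob _) _; apply: bndM; first exact: sqrtr_ge0.
  by apply: le_trans (bounded x i i0 u0); rewrite addrAC lerDr addr_ge0// sqr_ge0.
have m_lip x y i j : `|m x i j - m y i j| <= L * `|x - y|.
  apply: lipL => //; apply: le_trans (lipschitz x y i j u0).
  by rewrite lerDr addr_ge0// sqr_ge0.
have m_bound x i j : `|m x i j| <= M.
  apply: bndM => //; apply: le_trans (bounded x i j u0).
  by rewrite lerDr addr_ge0// sqr_ge0.
have b_cont' i u : continuous (fun x => b x i u).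
  by apply: (lipschitz_continuous_mx L0) => x y; exact: b_lip.
have P_repr x i u : noise_repr W (P x i u) (ctmc_trans h (m x) i)
    (em_map b sigma h x i u).
  exact: (em_noise_repr b_cont' sigma_cont WE m_ge0 m_sum0 h0).
have Kn_meas n : measurable (Kn n) by exact: compact_measurable_mx.
have Kn_ball := exhaustion_ball Kn_int Kn_cover.
have Pn_stoch n x i u : stochastic (Pn n x i u).
  apply: (cstate_stochastic b_cont' sigma_cont WE m_ge0 m_sum0 h0) => //.
  by move=> i' j'; apply: (ctmc_coef_measurable L0 h0 m_lip m_bound).
(* A common bound for the one-stage costs [ch] and the terminal costs. *)
pose B := h * M3 + M3.
have hM0 : 0 <= h * M3 by rewrite mulr_ge0// ltW.
have B0 : 0 <= B by rewrite addr_ge0// ltW.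
have ch_bound x i u : `|ch x i u| <= B.
  apply: (@le_trans _ _ (h * M3)); last by rewrite lerDl ltW.
  rewrite normrM ger0_norm// ler_wpM2l//.
  by apply: le_trans (cost_bounded x i u); rewrite lerDl.
have cT_bound x i : `|cT x i| <= B.
  apply: (@le_trans _ _ M3); last by rewrite lerDr.
  by apply: le_trans (cost_bounded x i u0); rewrite lerDr.
have cn_bound n x i u : `|cn n x i u| <= B.
  rewrite /cn /cstate_cost; case: ifP => _ //.
  by apply: fine_integral_bounded => //; exact: measurableC.
have cTn_bound n x i : `|cTn n x i| <= B.
  rewrite /cTn /cstate_term; case: ifP => _ //.
  by apply: fine_integral_bounded => //; exact: measurableC.
have CLc0 := ltW CLc_gt0.
have k0 : 0 <= CLc * d%:R by rewrite mulr_ge0.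
have hk0 : 0 <= h * (CLc * d%:R) by rewrite mulr_ge0.
have ch_uc e : 0 < e -> exists2 s, 0 < s & forall x y i u, `|x - y| <= s ->
    `|ch x i u - ch y i u| <= e.
  move=> e0; exists (e / (h * (CLc * d%:R) + 1)).
    by rewrite divr_gt0// ltr_wpDl.
  move=> x y i u xy; rewrite /ch -mulrBr normrM (ger0_norm h0).
  apply: (@le_trans _ _ (h * (CLc * d%:R) * `|x - y|)).
    rewrite -mulrA ler_wpM2l//; apply: le_trans (c_lipschitz x y i u u) _.
    by rewrite mdistxx addr0 -mulrA ler_wpM2l// enorm_le_mx_norm.
  exact: ler_mul_divD1.
have cT_uc : unif_cont cT.
  move=> e e0; exists (e / (CLc * d%:R + 1)); first by rewrite divr_gt0// ltr_wpDl.
  move=> x y i xy; apply: le_trans (cT_lipschitz x y i) _.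
  apply: (@le_trans _ _ (CLc * d%:R * `|x - y|)); last exact: ler_mul_divD1.
  by rewrite -mulrA ler_wpM2l// enorm_le_mx_norm.
have P_uc V C (VC : bounded_fun V C) (uV : unif_cont V) e :=
  @kernel_int_unif_cont R d N U b sigma m h L M L0 h0 b_lip s_lip m_lip m_bound
    W P_repr V C VC uV e.
have cn_cvg rho : exists n0, forall n x, (n0 <= n)%N -> `|x| <= rho ->
    (forall i u, cn n x i u = ch x i u) /\ (forall i, cTn n x i = cT x i).
  have [n0 n0P] := Kn_ball rho; exists n0 => n x nn xr.
  have xK : x \in Kn n by apply/mem_set; exact: n0P.
  by split => [i u|i]; rewrite /cn /cTn /cstate_cost /cstate_term xK.
have P_cvg F V C C' := @kernel_int_cvg R d N U b sigma m h M h0 b_bound s_bound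
  W P_repr (fun=> P) (fun=> id) F V C C'.
have P_cvg' F V C C' := P_cvg F V C C' (fun rho => ex_intro _ 0%N
  (fun n x _ _ => conj erefl (P_repr x))).
(* Once [Kn n] contains the ball, the averaged kernel at the pseudo-state is not seen from it. *)
have Pn_repr rho : exists n0, forall n x, (n0 <= n)%N -> `|x| <= rho ->
    collapse (Kn n) (Delta n) x = x /\
    forall i u, noise_repr W (Pn n x i u) (ctmc_trans h (m x) i)
      (collapse (Kn n) (Delta n) \o em_map b sigma h x i u).
  have [n0 n0P] := Kn_ball rho; exists n0 => n x nn xr.
  have xK : x \in Kn n by apply/mem_set; exact: n0P.
  split=> [|i u]; first by rewrite /collapse xK.
  have -> : Pn n x i u = collapsed_kernel P (Kn n) (Delta n) x i u.
    by apply/funext => j; apply/funext => A; rewrite /Pn /cstate_kernel xK.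
  exact: (collapsed_noise_repr b_cont' sigma_cont WE m_ge0 m_sum0 h0).
have Pn_cvg F V C C' := @kernel_int_cvg R d N U b sigma m h M h0 b_bound s_bound
  W P_repr Pn (fun n => collapse (Kn n) (Delta n)) F V C C' Pn_repr.
have P_stoch x i u := noise_stochastic (P_repr x i u).
have opt_cvg := opt_to_go_cvg u0 B0 P_stoch Pn_stoch ch_bound cT_bound cn_bound
  cTn_bound ch_uc cT_uc P_uc cn_cvg Pn_cvg.
(* What remains is that the policy costs of the compact models converge to the optimal value: half
   of [e] pays for [eps n], the other half for the convergence of the optimal values. *)
apply: (cost_to_go_cvg u0 B0 P_stoch Pn_stoch ch_bound cT_bound cn_bound
  cTn_bound ch_uc cT_uc P_uc cn_cvg P_cvg' Pn_cvg) => {}r rK rho e e0.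
have e2 : 0 < e / 2 by rewrite divr_gt0.
have [n1 n1P] := opt_cvg r rho _ e2.
have [n2 n2P] := Kn_ball rho.
have /cvgrPdist_le /(_ _ e2)[n3 _ n3P] := eps_cvg0.
exists (maxn n1 (maxn n2 n3)) => n x i.
rewrite !geq_max => /and3P[nn1 nn2 nn3] xr.
have h1 := n1P n x i nn1 xr.
have xX : cstate (Kn n) (Delta n) x by left; exact: n2P.
(* [K - r] is the stage with [r] stages left; the reindexing uses [r <= K]. *)
have h2 := le_sup_abs i (eps_opt n (K - r)%N (leq_subr _ _)) xX.
have h3 := n3P n nn3; rewrite /= sub0r normrN gtr0_norm// in h3.
rewrite /policy_cost /opt_value (subKn rK) in h2.
apply: le_trans (ler_distD (opt_to_go (cn n) (cTn n) (kernel_int (Pn n)) r x i) _ _) _.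
by move: h1 h2 h3; rewrite /=; lra.
Qed.
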